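(* Let $n$ be a natural number and $p$ a prime with $p\geq n$. Let $\mathcal{E}_p^n$ be a set of representatives of the isomorphism classes of groups of order $p^n$ and exponent $p$. For $E\in\mathcal{E}_p^n$, let $N_E$ be the set of group endomorphisms $\sigma:E\to E$ such that $\mathrm{Im}\,\sigma\subseteq Z(E)$ and $\sigma^n$ is the trivial endomorphism (sending all of $E$ to the identity). The group $\mathrm{Aut}(E)$ acts on $N_E$ by conjugation, and for $\phi\in N_E$ let $\phi^{\mathrm{Aut}(E)}$ denote its orbit. Then the number of isomorphism classes of groups of order $p^n$ whose derived subgroup has exponent dividing $p$ equals $$\sum_{E\in\mathcal{E}_p^n}\ \sum_{\phi\in N_E}\frac{1}{\lvert\phi^{\mathrm{Aut}(E)}\rvert}.$$
   Context: $Z(E)$ is the centre of $E$; $\sigma^n$ denotes the $n$-fold composite of $\sigma$. *)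

(* Defs.v *)
From HB Require Import structures.
From mathcomp Require Import all_boot all_order all_algebra all_fingroup all_solvable.
Set Implicit Arguments. Unset Strict Implicit. Unset Printing Implicit Defensive.
Import GRing.Theory.

Definition gprop := forall gT : finGroupType, Prop.

(* [iso_reps P k T] : T 0, ..., T (k-1) is a set of representatives of the
   isomorphism classes of finite groups satisfying P: each satisfies P, they
   are pairwise non-isomorphic, and every finite group satisfying P is
   isomorphic to one of them.  Thus k is "the number of isomorphism classes". *)
Definition iso_reps (P : gprop) (k : nat) (T : 'I_k -> finGroupType) : Prop :=
  [/\ forall i, P (T i),
      forall i j, [set: T i] \isog [set: T j] -> i = j
    & forall gT : finGroupType, P gT -> exists i, [set: gT] \isog [set: T i]].

(* groups of order p^n and exponent p (read as: exponent dividing p) *)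
Definition order_exp_p (p n : nat) : gprop := fun gT =>
  #|[set: gT]| = (p ^ n)%N /\ (exponent [set: gT] %| p)%N.

Definition order_derived_exp_p (p n : nat) : gprop := fun gT =>
  #|[set: gT]| = (p ^ n)%N /\ (exponent ([set: gT]^`(1))%g %| p)%N.

Definition N_E (n : nat) (gT : finGroupType) : {set {ffun gT -> gT}} :=
  [set s : {ffun gT -> gT} |
     [&& morphic [set: gT] s,
         (s @: [set: gT]) \subset ('Z([set: gT]))%g
       & [forall x, iter n s x == 1%g]]].

Definition conj_endo (gT : finGroupType) (a : {perm gT}) (s : {ffun gT -> gT})
  : {ffun gT -> gT} := [ffun x => a (s ((a^-1)%g x))].

Definition aut_orbit (gT : finGroupType) (s : {ffun gT -> gT}) :
  {set {ffun gT -> gT}} := [set conj_endo a s | a in Aut [set: gT]].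

Local Open Scope ring_scope.
Definition orbit_sum (n : nat) (gT : finGroupType) : rat :=
  \sum_(s in N_E n gT) (#|aut_orbit s|%:R)^-1.

(* Main.v *)
(* Attach to a group X with a central nilpotent endomorphism t the pair (X, t):
   on the one side X has exponent p and t is an element of N_E, on the other side
   X has order p^n, exponent of X' dividing p, and t is the p-power map.  As the
   class of X is less than p, the p-power map of such an X is indeed a central
   endomorphism; this follows from the fact that sequences polynomial for the
   lower central series form a group (Lazard, Leibman).

   The two sides are compared by near-homomorphisms (X, t) -> (Y, u): maps which
   are homomorphisms modulo u(Y), are exact on commutators and on ker t, and
   commute with the i-th powers of t and u modulo u^(i+1)(Y).
   - Two objects on the same side linked by a near-homomorphism are isomorphic:
     the obstruction to correcting the map f into a homomorphism is an extension
     of modules over F_p[t] (resp. Z) which f shows to be pure, hence split.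
   - Every object is linked, in both directions, to one on the other side.  The
     law x * y is replaced by x * y * z^c, where c is the carry in the addition
     of the digits chi(x), chi(y) for a character chi : X -> Z/p and a central
     element z of ker chi.  This multiplies the p-power map by z^chi, and a
     sequence of such steps along a flag refining the chain t^i(X) turns the
     trivial p-power map into one which agrees with t up to deeper terms of the
     chain, or conversely.
   So orbits of pairs (E, phi) correspond bijectively to the groups counted. *)
Require Import Defs.
From HB Require Import structures.
From mathcomp Require Import all_boot all_order all_algebra all_fingroup all_solvable.
From mathcomp Require Import zify.
Set Implicit Arguments. Unset Strict Implicit. Unset Printing Implicit Defensive.
Import GRing.Theory Num.Theory.
Local Open Scope group_scope.

(** * Polynomial sequences and the p-power map *)

Definition gnormE :=
  (@invMg, @invgK, @mulgA, @mulgK, @mulgKV, @mulVg, @mulgV, @mul1g, @mulg1, @invg1).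

Section PolynomialSequences.

Variables (gT : finGroupType) (G : {group gT}).
Implicit Types f g : nat -> gT.

Lemma three_subgroup_sub (A B C N : {group gT}) :
    A \subset 'N(N) -> B \subset 'N(N) -> C \subset 'N(N) ->
  [~: A, B, C] \subset N -> [~: B, C, A] \subset N -> [~: C, A, B] \subset N.
Proof.
move=> nA nB nC sABC sBCA.
have quo3 (A1 B1 C1 : {group gT}) : A1 \subset 'N(N) -> B1 \subset 'N(N) ->
    C1 \subset 'N(N) ->
  ([~: A1, B1, C1] \subset N) = ([~: A1 / N, B1 / N, C1 / N] \subset [1]).
  move=> nA1 nB1 nC1; have nAB : [~: A1, B1] \subset 'N(N) by rewrite comm_subG.
  rewrite -(quotientR nA1 nB1) -(quotientR nAB nC1) quotient_sub1 //.
  by rewrite comm_subG.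
move: sABC sBCA; rewrite !quo3 // => /trivgP sABC /trivgP sBCA.
by apply/trivgP; apply: three_subgroup.
Qed.

(** Induction by the three subgroups lemma modulo ['L_(m + n.+2)(G)]: the two permuted triple
    commutators fall under the hypothesis for [n], at [m] and at [m.+1]. *)
Lemma lcn_comm m n : [~: 'L_m(G), 'L_n(G)] \subset 'L_(m + n)(G).
Proof.
case: n => [|n].
  by rewrite addn0 (subset_trans (commgS _ (lcn_sub _ _))) // commg_subl lcn_norm.
elim: n m => [|n IHn] m; first by rewrite addn1 lcnSnS.
have nN k : 'L_k(G) \subset 'N('L_(m + n.+2)(G)).
  by rewrite (subset_trans (lcn_sub _ _)) ?lcn_norm.
rewrite lcnSn commGC; apply: three_subgroup_sub; rewrite ?nN ?lcn_norm //.
  rewrite (commGC G) (subset_trans (commSg _ (lcnSnS _ _))) //.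
  by rewrite addnS -addSn IHn.
by rewrite (subset_trans (commSg _ (IHn m))) // (addnS m n.+1) lcnSnS.
Qed.

Definition dseq f n := (f n)^-1 * f n.+1.

(** Polynomial sequences of Lazard and Leibman for the lower central series shifted by [m], with
    conditions on differences of order at most [k] only. *)
Fixpoint polyseq k m f :=
  (forall n, f n \in 'L_m(G)) /\ (if k is k'.+1 then polyseq k' m.+1 (dseq f) else True).

Lemma polyseq_val k m f n : polyseq k m f -> f n \in 'L_m(G).
Proof. by case: k => [|k] [/(_ n)]. Qed.

Lemma polyseqW k m f : polyseq k.+1 m f -> polyseq k m f.
Proof. by elim: k m f => [|k IHk] m f [f_m Df]; split=> //; apply: IHk. Qed.

Lemma polyseq_le k m l f : m <= l -> polyseq k l f -> polyseq k m f.
Proof.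
elim: k m l f => [|k IHk] m l f le_ml [f_l Df].
  by split=> // n; apply: subsetP (lcn_sub_leq _ le_ml) _ (f_l n).
split=> [n|]; last exact: IHk Df.
exact: subsetP (lcn_sub_leq _ le_ml) _ (f_l n).
Qed.

Lemma eq_polyseq k m f g : f =1 g -> polyseq k m f -> polyseq k m g.
Proof.
elim: k m f g => [|k IHk] m f g fg [f_m Df].
  by split=> // n; rewrite -fg.
by split=> [n|]; rewrite -?fg //; apply: IHk Df => n; rewrite /dseq !fg.
Qed.

(* Truncating the condition at order [k] makes the commutator case a plain induction:
   its terms such as [[~ [~ f, g], dseq g]] only involve [[~ f, g]] at the previous order. *)
Lemma polyseq_closed k :
  [/\ forall m f g, polyseq k m f -> polyseq k m g -> polyseq k m (fun n => f n * g n),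
      forall m f, polyseq k m f -> polyseq k m (fun n => (f n)^-1)
    & forall a b f g, polyseq k a f -> polyseq k b g ->
        polyseq k (a + b) (fun n => [~ f n, g n])].
Proof.
have lcR a b x y : x \in 'L_a(G) -> y \in 'L_b(G) -> [~ x, y] \in 'L_(a + b)(G).
  by move=> x_a y_b; apply: subsetP (lcn_comm _ _) _ (mem_commg x_a y_b).
elim: k => [|k [IHM IHV IHR]].
  split=> [m f g [f_m _] [g_m _]|m f [f_m _]|a b f g [f_a _] [g_b _]]; split=> // n.
  - by rewrite groupM.
  - by rewrite groupV.
  - exact: lcR.
have RL a b c f g : c <= a + b -> polyseq k a f -> polyseq k b g ->
    polyseq k c (fun n => [~ f n, g n]).
  by move=> le_c Pf Pg; apply: polyseq_le le_c (IHR _ _ _ _ Pf Pg).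
split=> [m f g|m f|a b f g].
- move=> Pf Pg; have [f_m Df] := Pf; have [g_m Dg] := Pg.
  split=> [n|]; first by rewrite groupM.
  apply: (@eq_polyseq _ _ (fun n => dseq f n * [~ dseq f n, g n] * dseq g n)).
    by move=> n; rewrite /dseq commgEl conjgE !gnormE.
  apply: (IHM) => //; apply: (IHM) => //.
  by apply: RL Df (polyseqW Pg); lia.
- move=> Pf; have [f_m Df] := Pf; split=> [n|]; first by rewrite groupV.
  apply: (@eq_polyseq _ _ (fun n => (dseq f n)^-1 * [~ (dseq f n)^-1, (f n)^-1])).
    by move=> n; rewrite /dseq commgEl conjgE !gnormE.
  apply: (IHM); first exact: IHV.
  by apply: RL (IHV _ _ Df) (IHV _ _ (polyseqW Pf)); lia.
- move=> Pf Pg; have [f_m Df] := Pf; have [g_m Dg] := Pg.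
  split=> [n|]; first exact: lcR.
  have Pf' := polyseqW Pf; have Pg' := polyseqW Pg.
  have PgD : polyseq k b (fun n => g n * dseq g n).
    by apply: (IHM) => //; apply: polyseq_le Dg.
  apply: (@eq_polyseq _ _ (fun n =>
     [~ f n, dseq g n] * [~ [~ f n, dseq g n], [~ f n, g n]]
     * [~ [~ f n, g n], dseq g n]
     * [~ [~ f n, g n * dseq g n], dseq f n]
     * [~ dseq f n, g n * dseq g n])).
    by move=> n; rewrite /dseq !commgEl !conjgE !gnormE.
  have Pfg := IHR _ _ _ _ Pf' Pg'.
  have Pfdg := IHR _ _ _ _ Pf' Dg.
  have Pdfg := IHR _ _ _ _ Df PgD.
  have Pfgd := IHR _ _ _ _ Pf' PgD.
  apply: (IHM); last by apply: polyseq_le Pdfg; lia.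
  apply: (IHM); last by apply: RL Pfgd Df; lia.
  apply: (IHM); last by apply: RL Pfg Dg; lia.
  apply: (IHM); first by apply: polyseq_le Pfdg; lia.
  by apply: RL Pfdg Pfg; lia.
Qed.

Lemma polyseq1 k m : polyseq k m (fun=> 1).
Proof.
elim: k m => [|k IHk] m; first by split=> // n; apply: group1.
split=> [n|]; first exact: group1.
by apply: eq_polyseq (IHk m.+1) => n; rewrite /dseq mulVg.
Qed.

(** By Pascal's rule a difference lowers [j] by one while it raises [m] by one. *)
Lemma polyseq_bin k j m c :
  c \in 'L_(m + j)(G) -> polyseq k m (fun n => c ^+ 'C(n, j)).
Proof.
elim: k j m => [|k IHk] j m c_mj;
  have c_m : c \in 'L_m(G) by apply: subsetP c_mj; apply: lcn_sub_leq; lia.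
  by split=> // n; apply: groupX.
split=> [n|]; first exact: groupX.
case: j c_mj => [|j] c_mj.
  by apply: eq_polyseq (polyseq1 k m.+1) => n; rewrite /dseq !bin0 mulVg.
apply: (@eq_polyseq _ _ (fun n => c ^+ 'C(n, j))) => [n|]; last first.
  by apply: IHk; rewrite addSnnS.
by rewrite /dseq binS expgD mulKg.
Qed.

Lemma dseq_vanish f s : (forall i, i < s -> f i = 1) ->
  forall j i, i + j < s -> iter j dseq f i = 1.
Proof.
move=> f1; elim=> [|j IHj] i lt_s; first by apply: f1; rewrite addn0 in lt_s.
by rewrite iterS /dseq !IHj ?mulg1 ?invg1 //; lia.
Qed.

(** Each difference moves the first possibly nontrivial entry one place to the left. For a
    polynomial sequence this puts [f s] in ['L_s(G)]. *)
Lemma dseq_last f s : (forall i, i < s -> f i = 1) -> iter s dseq f 0 = f s.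
Proof.
move=> f1.
have: forall j, j <= s -> iter j dseq f (s - j) = f s.
  elim=> [|j IHj] lt_j; first by rewrite subn0.
  rewrite iterS /dseq (dseq_vanish f1) ?invg1 ?mul1g; last by lia.
  by rewrite -IHj ?subSn //; [congr (iter _ _ _ _); lia | lia].
by move/(_ s (leqnn s)); rewrite subnn.
Qed.

Lemma polyseq_iter k m j f : polyseq (k + j) m f -> polyseq k (m + j) (iter j dseq f).
Proof.
elim: j m f => [|j IHj] m f; first by rewrite !addn0.
by rewrite addnS => -[_ /IHj]; rewrite addSnnS -iterSr.
Qed.

(** Discrete analogue of the vanishing of a polynomial of degree below [c] with [c] zeros. *)
Lemma dseq_const1 f c : (forall n, iter c dseq f n = 1) ->
  (forall i, i < c -> f i = 1) -> forall n, f n = 1.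
Proof.
elim: c f => [|c IHc] f Dc f1 n; first exact: (Dc n).
have D1 : forall m, dseq f m = 1.
  apply: IHc => [m|i lt_i]; first by rewrite -iterSr.
  by rewrite /dseq !f1 ?mulg1 ?invg1 //; lia.
elim: n => [|n IHn]; first exact: f1.
by have := D1 n; rewrite /dseq IHn invg1 mul1g.
Qed.

(* Multiplying [f] by the sequences [c ^+ 'C(n, s)] for s = 1, 2, ... makes it vanish at
   0, ..., p - 1 without changing [f p], as p divides the binomials. *)
Lemma polyseq_prime_value p f : prime p -> 'L_p(G) = 1 ->
    (forall k, polyseq k 0 f) -> f 0 = 1 ->
    (forall n, f n \in G^`(1)) -> (forall x, x \in G^`(1) -> x ^+ p = 1) ->
  f p = 1.
Proof.
move=> p_pr Lp1 Pf f0 fG' expG'; have p_gt0 := prime_gt0 p_pr.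
(* Induction on the number [d] of indices below [p] at which the sequence may still be nontrivial;
   [0 < p - d] keeps the binomials ['C(p, s)] away from [s = 0]. *)
have vanish d : 0 < p - d -> forall f, (forall k, polyseq k 0 f) ->
    (forall n, f n \in G^`(1)) -> (forall i, i < p - d -> f i = 1) -> f p = 1.
  elim: d => [_ | d IHd lt_d] h Ph hG' h1.
    rewrite subn0 in h1; apply: (dseq_const1 (c := p)) => // n.
    by have := polyseq_val n (polyseq_iter (Ph (0 + p)%N)); rewrite add0n Lp1 => /set1P.
  pose s := (p - d.+1)%N; have ps : (p - d)%N = s.+1 by rewrite /s; lia.
  have hs : h s \in 'L_s(G).
    by rewrite -dseq_last //; have := polyseq_val 0 (polyseq_iter (Ph (0 + s)%N)).
  have := IHd _ (fun n => (h s ^+ 'C(n, s))^-1 * h n).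
  have -> : h s ^+ 'C(p, s) = 1.
    have /dvdnP[e ->] : p %| 'C(p, s) by apply: prime_dvd_bin => //; rewrite /s; lia.
    by rewrite mulnC expgM expG' ?expg1n.
  rewrite invg1 mul1g; apply; first by rewrite ps.
  - move=> k; have [PM PV _] := polyseq_closed k.
    by apply: PM => //; apply: PV; apply: polyseq_bin; rewrite add0n.
  - by move=> n; rewrite groupM ?groupV ?groupX.
  move=> i; rewrite ps ltnS leq_eqVlt => /predU1P[->|lt_is].
    by rewrite binn expg1 mulVg.
  by rewrite bin_small // expg0 invg1 mul1g h1.
apply: (vanish p.-1) => // [|i]; first by lia.
by case: i => // i; lia.
Qed.

(** The sequence [(x y)^-n x^n y^n] is a product of polynomial sequences and takes values in the
    derived subgroup, so it is trivial at [p]. *)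
Theorem expgMn_der1 p : prime p -> 'L_p(G) = 1 -> (forall x, x \in G^`(1) -> x ^+ p = 1) ->
  {in G &, forall x y, (x * y) ^+ p = x ^+ p * y ^+ p}.
Proof.
move=> p_pr Lp1 expG' x y Gx Gy.
have Pexp z k : z \in G -> polyseq k 0 (fun n => z ^+ n).
  by move=> Gz; apply: (@eq_polyseq _ _ (fun n => z ^+ 'C(n, 1))) => [n|];
     [rewrite bin1 | exact: polyseq_bin].
pose f n := ((x * y) ^+ n)^-1 * (x ^+ n * y ^+ n).
suffices: f p = 1 by rewrite /f => /(canRL (mulKVg _)); rewrite mulg1.
apply: polyseq_prime_value => // [k | | n].
- have [PM PV _] := polyseq_closed k.
  by apply: (PM); [apply: PV | apply: PM]; apply: Pexp; rewrite ?groupM.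
- by rewrite /f !expg0 !mulg1 invg1.
have nG' z : z \in G -> z \in 'N(G^`(1)) by apply/subsetP; rewrite der_norm.
apply: coset_idr; first by rewrite !(groupM, groupV, groupX) ?nG'.
rewrite !(morphM, morphV, morphX) ?(groupM, groupV, groupX) ?nG' //=.
rewrite expgMn ?mulVg //.
have /centsP := der_abelian 0 G; rewrite /=.
by apply; rewrite mem_quotient.
Qed.

(** Additivity of the power map gives [[x^p, y] = x^-p (x^y)^p = [x, y]^p = 1]. *)
Theorem expgp_central p : prime p -> 'L_p(G) = 1 -> (forall x, x \in G^`(1) -> x ^+ p = 1) ->
  {in G, forall x, x ^+ p \in 'Z(G)}.
Proof.
move=> p_pr Lp1 expG' x Gx; apply/centerP; split=> [|y Gy]; first exact: groupX.
apply/commgP; rewrite commgEl conjXg -expgVn -expgMn_der1 ?groupV ?groupJ //.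
by apply/eqP/expG'/mem_commg.
Qed.

End PolynomialSequences.

(** * Complements of pure subgroups *)

Lemma coprime_expg_mem (gT : finGroupType) (H : {group gT}) x a b :
  0 < a -> coprime a b -> x ^+ a \in H -> x ^+ b \in H -> x \in H.
Proof.
move=> a_gt0 /eqP co_ab Ha Hb.
case: (egcdnP b a_gt0) => u v; rewrite co_ab => Duv _.
have: x ^+ (u * a) \in H by rewrite mulnC expgM groupX.
by have Hv := groupX v Hb; rewrite Duv expgD mulnC expgM expg1 groupMl.
Qed.

Section PureComplement.

(* Everything below is a statement about the abelian group [P / D] with the
   operator induced by [t]; [K] is pure in it and gets a [t]-stable complement. *)
Variables (gT : finGroupType) (P D K : {group gT}) (t : gT -> gT) (p : nat).
Hypotheses (p_pr : prime p) (sDP : D \subset P).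
Hypothesis commD : {in P &, forall x y, [~ x, y] \in D}.
Hypothesis tM : {in P &, {morph t : x y / x * y}}.
Hypothesis tP : {in P, forall x, t x \in P}.
Hypothesis tD : {in D, forall x, t x = 1}.
Hypothesis t_nil : exists N, {in P, forall x, iter N t x = 1}.
(** Covers both applications: [x ^+ p = 1] for modules over F_p[t], and [t x = x ^+ p] for modules
    over Z. *)
Hypothesis t_pow : forall (H : {group gT}) x,
  x \in P -> D \subset H -> t x \in H -> x ^+ p \in H.

Implicit Types F H M : {group gT}.

Let stable (H : {set gT}) := {in H, forall x, t x \in H}.
Let pure (H : {set gT}) := forall i q, q \in P -> iter i t q \in H ->
  exists2 k, k \in H & (iter i t k)^-1 * iter i t q \in D.

Let itP i x : x \in P -> iter i t x \in P.
Proof. by move=> Px; elim: i => //= i; apply: tP. Qed.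

Let itM i : {in P &, {morph iter i t : x y / x * y}}.
Proof. by move=> x y Px Py; elim: i => //= i ->; rewrite tM ?itP. Qed.

Let it1 i : iter i t 1 = 1.
Proof. by elim: i => //= i ->; rewrite tD. Qed.

Let itV i x : x \in P -> iter i t x^-1 = (iter i t x)^-1.
Proof.
by move=> Px; apply/eqP; rewrite eq_sym eq_invg_mul -itM ?groupV // mulgV it1.
Qed.

Let itX i x e : x \in P -> iter i t (x ^+ e) = iter i t x ^+ e.
Proof.
by move=> Px; elim: e => [|e IHe]; rewrite ?it1 // !expgS itM ?groupX // IHe.
Qed.

Let tX x e : x \in P -> t (x ^+ e) = t x ^+ e.
Proof. exact: (@itX 1). Qed.

Let tV x : x \in P -> t x^-1 = (t x)^-1.
Proof. exact: (@itV 1). Qed.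

Let it_stable H i x : stable H -> x \in H -> iter i t x \in H.
Proof. by move=> tH Hx; elim: i => //= i; apply: tH. Qed.

Let normP H : D \subset H -> H \subset P -> P \subset 'N(H).
Proof.
move=> sDH sHP; apply/subsetP=> x Px; rewrite inE; apply/subsetP=> _ /imsetP[h Hh ->].
by rewrite conjg_mulR groupM // (subsetP sDH) // commD // (subsetP sHP).
Qed.

Let joinE H1 H2 : D \subset H1 -> H1 \subset P -> H2 \subset P -> H1 <*> H2 = H1 * H2.
Proof.
by move=> sDH sHP sH2P; rewrite norm_joinEr // (subset_trans sH2P) ?normP.
Qed.

(** The invariant of the construction; purity of [F * K] is what allows the next enlargement. *)
Let good F := [/\ D \subset F, F \subset P, stable F, F :&: K \subset D
                & pure (F * K)].

Hypotheses (sDK : D \subset K) (sKP : K \subset P) (stK : stable K) (pureK : pure K).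

(** * Enlargement by a cyclic submodule *)

Section Step.
Variables (F : {group gT}) (gF : good F) (neP : F * K != P).
Let M := (F <*> K)%G.
Let sDF : D \subset F. Proof. by case: gF. Qed.
Let sFP : F \subset P. Proof. by case: gF. Qed.
Let stF : stable F. Proof. by case: gF. Qed.
Let ME : M = F * K :> {set gT}. Proof. exact: joinE. Qed.
Let sMP : M \subset P. Proof. by rewrite join_subG sFP. Qed.
Let sFM : F \subset M. Proof. exact: joing_subl. Qed.
Let sKM : K \subset M. Proof. exact: joing_subr. Qed.
Let sDM : D \subset M. Proof. exact: subset_trans sFM. Qed.
Let pureM : pure M. Proof. by rewrite ME; case: gF. Qed.
Let stM : stable M.
Proof.
move=> x; rewrite ME => /mulsgP[f k Ff Kk ->].
by rewrite tM ?(subsetP sFP f) ?(subsetP sKP k) // mem_mulg ?stF ?stK.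
Qed.

(** [m] is the exponent of [P / M] under [t] and [y] attains it; moreover [y] is killed by the
    [m]-th iterate modulo [D], not merely modulo [M]. *)
Variables (m : nat) (y : gT).
Hypotheses (m_gt0 : 0 < m) (Py : y \in P) (mM : {in P, forall x, iter m t x \in M}).
Hypotheses (tmy : iter m t y \in D) (tm1y : iter m.-1 t y \notin M).

(* Modulo [D], the [t]-submodule generated by [iter (m - d) t y]. *)
Fixpoint cyc d : {group gT} :=
  if d is d'.+1 then (cyc d' <*> <[iter (m - d) t y]>)%G else D.

Let sDC d : D \subset cyc d.
Proof. by elim: d => //= d IHd; apply: subset_trans (joing_subl _ _). Qed.
Let sCP d : cyc d \subset P.
Proof. by elim: d => //= d IHd; rewrite join_subG IHd cycle_subG itP. Qed.
Let cycS d : cyc d \subset cyc d.+1. Proof. exact: joing_subl. Qed.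

Let cycSP d x : x \in cyc d.+1 ->
  exists e, exists2 c, c \in cyc d & x = c * iter (m - d.+1) t y ^+ e.
Proof.
rewrite /= joinE ?cycle_subG ?itP // => /mulsgP[c _ Cc /cycleP[e ->] ->].
by exists e, c.
Qed.

Let Ciy d : d <= m -> iter (m - d) t y \in cyc d.
Proof.
case: d => [_|d _]; first by rewrite subn0.
by rewrite (subsetP (joing_subr _ _)) ?cycle_id.
Qed.

Let cyc_t d x : d < m -> x \in cyc d.+1 -> t x \in cyc d.
Proof.
elim: d x => [|d IHd] x lt_d /cycSP[e [c Cc ->]].
  rewrite tM ?(subsetP sDP c) ?groupX ?itP // groupM //; first by rewrite tD.
  by rewrite tX ?itP // groupX // -iterS subnSK // subn0.
have Pc := subsetP (sCP _) _ Cc.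
rewrite tM ?groupX ?itP // groupM //; first by rewrite (subsetP (cycS _)) ?IHd // ltnW.
by rewrite tX ?itP // groupX // -iterS subnSK // Ciy // ltnW.
Qed.

Let cyc_it i d x : d <= m -> x \in cyc d -> iter i t x \in cyc (d - i).
Proof.
elim: i d x => [|i IHi] d x le_dm Cx; first by rewrite subn0.
rewrite iterSr; case: d le_dm Cx => [|d] le_dm Cx.
  by rewrite tD // it1 group1.
by rewrite subSS; apply: IHi; [apply: ltnW | apply: cyc_t].
Qed.

Let cyc_onto1 d x : d < m -> x \in cyc d -> exists2 c, c \in cyc d.+1 & (t c)^-1 * x \in D.
Proof.
elim: d x => [|d IHd] x lt_dm Cx.
  by exists 1; rewrite ?group1 // tD ?invg1 ?mul1g.
have [e [c Cc ->]] := cycSP Cx; have [c' Cc' tc'] := IHd _ (ltnW lt_dm) Cc.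
have [Pc Pc'] := (subsetP (sCP _) _ Cc, subsetP (sCP _) _ Cc').
exists (c' * iter (m - d.+2) t y ^+ e).
  by apply: groupM; [apply: subsetP Cc'; apply: cycS | rewrite groupX ?Ciy].
rewrite tM ?groupX ?itP // tX ?itP // -iterS subnSK //.
rewrite invMg -mulgA [X in _ * X]mulgA -conjgE memJ_norm //.
by rewrite (subsetP (normP _ sDP)) // groupX ?itP.
Qed.

Let cyc_onto i x : i <= m -> x \in cyc (m - i) ->
  exists2 c, c \in cyc m & (iter i t c)^-1 * x \in D.
Proof.
elim: i x => [|i IHi] x le_im Cx.
  by rewrite subn0 in Cx; exists x; rewrite ?mulVg ?group1.
have lt_m : m - i.+1 < m by rewrite ltn_subrL m_gt0.
have [c1 Cc1 tc1] := cyc_onto1 lt_m Cx; rewrite subnSK // in Cc1.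
have [c Cc tc] := IHi c1 (ltnW le_im) Cc1.
have Pc := subsetP (sCP _) _ Cc; have Pc1 := subsetP (sCP _) _ Cc1.
exists c => //; suff -> : iter i.+1 t c = t c1 by [].
have := tD tc; rewrite tM ?groupV ?itP // tV ?itP // => /(canRL (mulKVg _)) ->.
by rewrite mulg1.
Qed.

(* The exponent [e] below is divisible by [p] because [iter m.-1 t y] has order [p]
   modulo [M]. *)
Let cyc_sect d a c : a <= d -> d <= m -> c \in cyc d -> iter a t c \in M -> c \in cyc a.
Proof.
elim: d c => [|d IHd] c; first by rewrite leqn0 => /eqP->.
rewrite leq_eqVlt => /predU1P[-> // |]; rewrite ltnS => le_ad lt_dm Cc Mac.
apply: (IHd _ le_ad (ltnW lt_dm) _ Mac).
have [e [c' Cc' Dc]] := cycSP Cc; have Pc' := subsetP (sCP _) _ Cc'.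
have Pz := itP (m - d.+1) Py; set z := iter _ t y in Dc Pz.
have Mdc : iter d t c \in M by rewrite -(subnK le_ad) iterD; apply: it_stable stM Mac.
have tdz : iter d t z = iter m.-1 t y.
  by rewrite -iterD -(prednK m_gt0) subSS subnKC // -ltnS prednK.
have Mze : iter m.-1 t y ^+ e \in M.
  have Pze := groupX e Pz; move: Mdc; rewrite Dc itM // itX // tdz groupMl //.
  by rewrite (subsetP sDM) //; have := cyc_it d (ltnW lt_dm) Cc'; rewrite subnn.
have Mzp : iter m.-1 t y ^+ p \in M.
  by apply: t_pow; rewrite ?itP // -iterS prednK // (subsetP sDM).
have p_e : p %| e.
  apply: contraR tm1y => pe; apply: coprime_expg_mem Mzp Mze; first exact: prime_gt0.
  by rewrite prime_coprime.
rewrite Dc groupM //; have /dvdnP[e' ->] := p_e; rewrite mulnC expgM groupX //.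
(* The power [z ^+ p] lies in [cyc d] because [t z] does. *)
by apply: t_pow; rewrite // -iterS subnSK // Ciy // ltnW.
Qed.

Let C := cyc m.
Let stC : stable C.
Proof.
move=> x Cx; have := cyc_it 1 (leqnn m) Cx; rewrite subn1 /= => Ctx.
have sC : cyc m.-1 \subset C by rewrite /C -[in cyc m](prednK m_gt0) cycS.
exact: subsetP Ctx.
Qed.

(** By [cyc_sect] with [a = 0], [C] meets [M] inside [D], so the intersection with [K] stays in [D].
    Purity is inherited from [M] once the [C]-component has been divided by a power of [t]. *)
Lemma good_step : good (F <*> C)%G /\ #|F| < #|(F <*> C)%G|.
Proof.
have [_ _ _ tiFK _] := gF; have [sDC' sCP'] := (sDC m, sCP m).
have FCE : F <*> C = F * C by apply: joinE.
have sFCP : F <*> C \subset P by rewrite join_subG sFP.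
split; last first.
  apply: proper_card; rewrite properE joing_subl; apply/subsetPn; exists y.
    by apply: subsetP (joing_subr _ _) _ _; have := Ciy (leqnn m); rewrite subnn.
  by apply: contra tm1y => Fy; apply: it_stable stM _; apply: subsetP Fy.
split=> //.
- exact: subset_trans (joing_subl _ _).
- move=> x /=; rewrite FCE => /mulsgP[f c Ff Cc ->].
  by rewrite tM ?(subsetP sFP f) ?(subsetP sCP' c) // mem_mulg ?stF ?stC.
- apply/subsetP=> x /setIP[] /=; rewrite FCE => /mulsgP[f c Ff Cc ->] Kfc.
  have Mc : c \in M.
    by rewrite -(groupMl c (subsetP sFM _ Ff)) (subsetP sKM).
  have Dc : c \in D by apply: (@cyc_sect m 0 c).
  by apply: (subsetP tiFK); rewrite inE Kfc groupMl // (subsetP sDF).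
move=> i q Pq /mulsgP[x k /=]; rewrite FCE => /mulsgP[f c Ff Cc ->] Kk Dq.
have Pk := subsetP sKP _ Kk.
have [mu [c1 [Mmu Cc1 Dq1]]] : exists mu c1, [/\ mu \in M, c1 \in C & iter i t q = mu * c1].
  exists (f * k), (c ^ k); split; first by rewrite ME mem_mulg.
    by rewrite memJ_norm // (subsetP (normP _ _)).
  by rewrite Dq -!mulgA -conjgC.
have sMFK : M \subset F * C * K by rewrite ME mulSg ?mulG_subl.
have [le_mi | lt_im] := leqP m i.
  have Mq : iter i t q \in M.
    by rewrite -(subnK le_mi) iterD; apply: it_stable stM _; apply: mM.
  have [k' Mk' Dk'] := pureM Pq Mq.
  by exists k' => //; apply: (subsetP sMFK).
(* Applying [t] another [m - i] times shows that [c1] lies in [cyc (m - i)], hence is [iter i t c']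
   modulo [D]; the quotient [q * c'^-1] is then handled by the purity of [M]. *)
have Pmu := subsetP sMP _ Mmu; have Pc1 := subsetP sCP' _ Cc1.
have Mc1 : iter (m - i) t c1 \in M.
  have: iter m t q \in M by apply: mM.
  by rewrite -{1}(subnK (ltnW lt_im)) iterD Dq1 itM // groupMl //; apply: it_stable stM Mmu.
have [|c' Cc' Dc'] := @cyc_onto i c1 (ltnW lt_im).
  by apply: (@cyc_sect m) => //; apply: leq_subr.
have Pc' := subsetP sCP' _ Cc'.
have Mq : iter i t (q * c'^-1) \in M.
  rewrite itM ?groupV // itV // Dq1 -mulgA groupMl // (subsetP sDM) //.
  have -> : c1 * (iter i t c')^-1 = ((iter i t c')^-1 * c1) ^ (iter i t c')^-1.
    by rewrite conjgE invgK !mulgA mulgV mul1g.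
  by rewrite memJ_norm // (subsetP (normP _ sDP)) // groupV itP.
have [mu' Mmu' Dmu'] := pureM (groupM Pq (groupVr Pc')) Mq.
have Pmu' := subsetP sMP _ Mmu'.
exists (mu' * c').
  have [f1 k1 Ff1 Kk1 ->] : imset2_spec mulg (mem F) (fun=> mem K) mu'.
    by apply/mulsgP; rewrite -ME.
  have Pk1 := subsetP sKP _ Kk1.
  have -> : f1 * k1 * c' = f1 * (c' ^ k1^-1) * k1 by rewrite conjgE invgK !mulgA mulgKV.
  rewrite mem_mulg // mem_mulg // memJ_norm // groupV.
  exact: subsetP (normP sDC' sCP') _ Pk1.
rewrite itM // invMg -mulgA.
move: Dmu'; rewrite itM ?groupV // itV //.
set u := iter i t mu'; set v := iter i t c'; set w := iter i t q => Duvw.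
have -> : v^-1 * (u^-1 * w) = (u^-1 * (w * v^-1)) ^ v by rewrite conjgE !mulgA mulgKV.
by rewrite memJ_norm // (subsetP (normP _ sDP)) ?itP.
Qed.
End Step.

(* A submodule [F] meeting [K] trivially with [F * K] pure can be enlarged by an element
   of maximal [t]-order modulo [F * K], as long as [F * K] is not everything. *)
Theorem pure_complement :
  exists F : {group gT}, [/\ D \subset F, F \subset P, {in F, forall x, t x \in F},
                            F :&: K \subset D & F * K = P].
Proof.
suffices max_good F : good F -> exists F', good F' /\ F' * K = P.
  have [|F [[sDF sFP stF tiFK _] FKP]] := max_good D; last by exists F.
  split=> //; last by rewrite mulSGid.
    by move=> x Dx; rewrite tD.
  exact: subsetIl.
have [n] := ubnP (#|P| - #|F|); elim: n F => // n IHn F lt_n gF.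
have [FKP | neP] := eqVneq (F * K) P; first by exists F.
have [sDF sFP stF tiFK pureFK] := gF.
have FKE : F <*> K = F * K by apply: joinE.
have [N tN] := t_nil.
have exm : exists m, [forall x in P, iter m t x \in F <*> K].
  by exists N; apply/forall_inP=> x Px; rewrite tN.
have [m /forall_inP mM minm] := ex_minnP exm.
have m_gt0 : 0 < m.
  rewrite lt0n; apply: contra neP => /eqP m0; rewrite -FKE eqEsubset join_subG sFP sKP.
  by apply/subsetP=> x /mM; rewrite m0.
have /forall_inPn[y0 Py0 ny0] : ~~ [forall x in P, iter m.-1 t x \in F <*> K].
  by apply/negP=> /minm; rewrite leqNgt ltn_predL m_gt0.
have := pureFK m y0 Py0; rewrite -FKE => /(_ (mM _ Py0))[k Mk Dk].
have sMP : F <*> K \subset P by rewrite join_subG sFP.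
have Pk := subsetP sMP _ Mk.
have Py : k^-1 * y0 \in P by rewrite groupM ?groupV.
have [] := @good_step F gF m (k^-1 * y0) m_gt0 Py mM.
- by rewrite itM ?groupV // itV.
- rewrite itM ?groupV // itV // groupMl // groupV it_stable //.
  move=> x; rewrite /= FKE => /mulsgP[f k' Ff Kk' ->].
  by rewrite tM ?(subsetP sFP f) ?(subsetP sKP k') // mem_mulg ?stF ?stK.
move=> gF' lt_F; have [_ /subset_leq_card le_F' _ _ _] := gF'; apply: (IHn _ _ gF').
rewrite -ltnS; apply: leq_trans lt_n; rewrite ltnS.
exact: ltn_sub2l (leq_trans lt_F le_F') lt_F.
Qed.

End PureComplement.

(** * Near-homomorphisms and their lifting *)

Lemma commg_central (gT : finGroupType) (x y u v : gT) :
    (forall g, commute u g) -> (forall g, commute v g) ->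
  [~ x * u, y * v] = [~ x, y].
Proof.
move=> cu cv; have J1 w : w ^ v = w by rewrite conjgE -cv mulKg.
have J2 w : u ^ w = u by rewrite conjgE cu mulKg.
have J3 w : w ^ u = w by rewrite conjgE -cu mulKg.
by rewrite commgEl conjgM J1 conjMg J2 invMg -mulgA [_^-1 * (_ * u)]mulgA -conjgE J3.
Qed.

Lemma pair_expg (gT1 gT2 : finGroupType) (x : gT1) (y : gT2) k :
  ((x, y) : gT1 * gT2) ^+ k = (x ^+ k, y ^+ k).
Proof. by elim: k => // k IHk; rewrite !expgS IHk. Qed.

(** The conditions defining [N_E], for a plain function, so that they also apply to the p-power
    map. *)
Definition cnil n (X : finGroupType) (t : X -> X) :=
  [/\ {morph t : x y / x * y}, forall x y, commute (t x) y & forall x, iter n t x = 1].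

(** In [nearhom_lift] the first clause yields purity, the second and third make [P] and [D] groups,
    and the last puts the commutators of [P] in [D]. *)
Definition nearhom (X : finGroupType) (t : X -> X) (X1 : finGroupType) (t1 : X1 -> X1)
    (f : X -> X1) :=
  [/\ forall i x, exists y, f (iter i t x) = iter i t1 (f x) * iter i.+1 t1 y,
      forall x y, exists z, f (x * y) = f x * f y * t1 z,
      forall b, t b = 1 ->
        [/\ t1 (f b) = 1, f b = 1 -> b = 1 & forall x, f (x * b) = f x * f b]
    & forall x y, f [~ x, y] = [~ f x, f y]].

Section Cnil.
Variables (n : nat) (X : finGroupType) (t : X -> X).
Hypothesis ct : cnil n t.

Lemma cnilM : {morph t : x y / x * y}. Proof. by case: ct. Qed.
Lemma cnilC x y : commute (t x) y. Proof. by case: ct => _ /(_ x y). Qed.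
Lemma cnil_iterM i : {morph iter i t : x y / x * y}.
Proof. by move=> x y; elim: i => //= i ->; rewrite cnilM. Qed.
Lemma cnil1 i : iter i t 1 = 1.
Proof. by apply: (@mulgI _ (iter i t 1)); rewrite -cnil_iterM !mulg1. Qed.
Lemma cnil_1 : t 1 = 1. Proof. exact: (cnil1 1). Qed.
Lemma cnil_iterV i x : iter i t x^-1 = (iter i t x)^-1.
Proof. by apply/eqP; rewrite eq_sym eq_invg_mul -cnil_iterM mulgV cnil1. Qed.
Lemma cnilV x : t x^-1 = (t x)^-1. Proof. exact: (cnil_iterV 1). Qed.
Lemma cnil_comm x y : t [~ x, y] = 1.
Proof. by rewrite commgEl conjgE !cnilM !cnilV (cnilC x (t y)) mulKg mulVg. Qed.
Lemma cnil_iter_le i j x : (forall y, iter i t y = 1) -> i <= j -> iter j t x = 1.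
Proof. by move=> ti /subnKC <-; rewrite iterD ti. Qed.
End Cnil.

Lemma nearhom1 (X X1 : finGroupType) (t : X -> X) (t1 : X1 -> X1) f n :
  cnil n t -> nearhom t t1 f -> f 1 = 1.
Proof.
move=> ct [_ _ nf3 _]; have [_ _ /(_ 1)] := nf3 1 (cnil_1 ct).
by rewrite mulg1 -{1}[f 1]mulg1 => /mulgI.
Qed.

Lemma nearhom_comp n (X X1 X2 : finGroupType)
    (t : X -> X) (t1 : X1 -> X1) (t2 : X2 -> X2) f g :
    cnil n t1 -> cnil n t2 ->
  nearhom t t1 f -> nearhom t1 t2 g -> nearhom t t2 (g \o f).
Proof.
move=> ct1 ct2 [f1 f2 f3 f4] [g1 g2 g3 g4].
(* As [g] sends the image of [t1] into that of [t2], errors of [f] become errors of the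
   composite. *)
have gT y : exists z, g (t1 y) = t2 z.
  have [z /= ->] := g1 1%N y; exists (g y * t2 z).
  by rewrite (cnilM ct2).
have gMT y z : exists w, g (y * t1 z) = g y * t2 w.
  have [w ->] := g2 y (t1 z); have [w' ->] := gT z.
  by exists (w' * w); rewrite (cnilM ct2) mulgA.
split=> [i x | x y | b tb | x y] /=.
- have [y ->] := f1 i x; rewrite iterSr -(cnil_iterM ct1).
  have [w ->] := g1 i (f x * t1 y); have [w' ->] := gMT (f x) y.
  by exists (w' * w); rewrite -iterS !iterSr (cnilM ct2) !(cnil_iterM ct2) mulgA.
- have [z ->] := f2 x y; have [w ->] := gMT (f x * f y) z.
  have [w' ->] := g2 (f x) (f y).
  by exists (w' * w); rewrite (cnilM ct2) mulgA.
- have [tfb fb1 fxb] := f3 b tb; have [tgb gb1 gxb] := g3 _ tfb.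
  by split=> // [/gb1/fb1 // | x]; rewrite fxb gxb.
- by rewrite f4 g4.
Qed.

Lemma nearhom_iso (X X1 : finGroupType) (t : X -> X) (t1 : X1 -> X1) n h :
  cnil n t1 -> {morph h : x y / x * y} -> injective h -> (forall x, h (t x) = t1 (h x)) ->
  nearhom t t1 h.
Proof.
move=> ct1 hM h_inj ht.
have h1 : h 1 = 1 by apply: (@mulgI _ (h 1)); rewrite -hM !mulg1.
have hV x : h x^-1 = (h x)^-1.
  by apply/eqP; rewrite eq_sym eq_invg_mul -hM mulgV h1.
split=> [i x|x y|b tb|x y].
- by exists 1; rewrite (cnil1 ct1) mulg1; elim: i => //= i IHi; rewrite ht IHi.
- by exists 1; rewrite (cnil_1 ct1) mulg1 hM.
- by rewrite -ht tb h1; split=> // hb1; apply: h_inj; rewrite h1.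
- by rewrite !commgEl !conjgE !hM !hV.
Qed.

(** * Lifting near-homomorphisms to isomorphisms *)

Section Lift.
Variables (p n : nat) (X X1 : finGroupType) (t : X -> X) (t1 : X1 -> X1) (f : X -> X1).
Hypotheses (p_pr : prime p) (ct : cnil n t) (ct1 : cnil n t1) (nf : nearhom t t1 f).

Let f1 : f 1 = 1 := nearhom1 ct nf.
Let tt (q : X * X1) := (t q.1, t1 q.2).

Let itt i q : iter i tt q = (iter i t q.1, iter i t1 q.2).
Proof. by elim: i => [|i /= ->] //; case: q. Qed.

Let fB b x : t b = 1 -> f (x * b) = f x * f b.
Proof. by have [_ _ nf3 _] := nf; move/nf3=> [_ _]. Qed.

Let P := [set q : X * X1 | [exists z, q.2 == f q.1 * t1 z]].
Let D := [set q : X * X1 | (t q.1 == 1) && (q.2 == f q.1)].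
Let B := [set q : X * X1 | t q.1 == 1].

Let inP x y : reflect (exists z, y = f x * t1 z) ((x, y) \in P).
Proof. by rewrite inE /=; apply: (iffP existsP) => [[z /eqP] | [z ->]]; exists z. Qed.

Let fxT x x' z z' : f x * t1 z * (f x' * t1 z') = f x * f x' * (t1 z * t1 z').
Proof. by rewrite -!mulgA; congr (_ * _); rewrite !mulgA (cnilC ct1 z). Qed.

Let P_group : group_set P.
Proof.
have [nf1 nf2 nf3 nf4] := nf.
apply/group_setP; split; first by apply/inP; exists 1; rewrite f1 (cnil_1 ct1) mulg1.
move=> [x y] [x' y'] /inP[z ->] /inP[z' ->]; apply/inP => /=.
have [w ->] := nf2 x x'; exists (w^-1 * (z * z')).
by rewrite fxT !(cnilM ct1) (cnilV ct1) !mulgA mulgK.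
Qed.

Let D_group : group_set D.
Proof.
apply/group_setP; split; first by rewrite inE /= f1 (cnil_1 ct) !eqxx.
move=> [x y] [x' y']; rewrite !inE /= => /andP[/eqP tx /eqP->] /andP[/eqP tx' /eqP->].
by rewrite (cnilM ct) tx tx' mulg1 fB ?eqxx.
Qed.

Let B_group : group_set B.
Proof.
apply/group_setP; split; first by rewrite inE /= (cnil_1 ct).
by move=> q q'; rewrite !inE => /eqP tq /eqP tq'; rewrite (cnilM ct) tq tq' mulg1.
Qed.

(* The graph of the lift is a [t]-stable complement, modulo the graph [D] of [f] on the
   kernel of [t], of the part of [P] lying over that kernel; [P] consists of the pairs
   (x, y) with y congruent to [f x] modulo the image of [t1]. *)
Theorem nearhom_lift : #|X| = #|X1| ->
    (forall x : X, x ^+ p = 1) /\ (forall x : X1, x ^+ p = 1) \/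
    (forall x, t x = x ^+ p) /\ (forall x, t1 x = x ^+ p) ->
  exists h, [/\ {morph h : x y / x * y}, bijective h & forall x, h (t x) = t1 (h x)].
Proof.
move=> eqX pow; have [nf1 nf2 nf3 nf4] := nf.
have c1 z g : commute (t1 z) g by apply: cnilC ct1 z g.
have tP : {in P, forall q, tt q \in P}.
  move=> [x y] _; apply/inP => /=; have [y0 /= ->] := nf1 1%N x.
  exists ((f x * t1 y0)^-1 * y).
  by rewrite !(cnilM ct1) (cnilV ct1) !(cnilM ct1) mulKVg.
have [] := @pure_complement _ (Group P_group) (Group D_group)
  (Group P_group :&: Group B_group)%G tt p p_pr.
- apply/subsetP=> [[x y]] /=; rewrite inE => /andP[/= _ /eqP->].
  by apply/inP; exists 1; rewrite (cnil_1 ct1) mulg1.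
- move=> [x y] [x' y'] /= /inP[z ->] /inP[z' ->].
  rewrite -[commg _ _]/([~ x, x'], [~ f x * t1 z, f x' * t1 z']) inE.
  rewrite (cnil_comm ct) eqxx commg_central //=.
  by rewrite nf4.
- by move=> [x y] [x' y'] _ _; rewrite /tt /= (cnilM ct) (cnilM ct1).
- exact: tP.
- move=> [x y] /=; rewrite inE /= => /andP[/eqP tx /eqP->].
  by have [tfx _ _] := nf3 x tx; rewrite /tt /= tx tfx.
- by exists n => q _; rewrite itt; case: ct ct1 => _ _ -> [_ _ ->].
- move=> H [x y] _ _ /=; rewrite /tt /= pair_expg.
  by case: pow => [[-> ->] | [<- <-]] //; rewrite (group1 H).
- apply/subsetP=> [[x y]] /=; rewrite !inE => /andP[/= -> /eqP->].
  by rewrite andbT; apply/existsP; exists 1; rewrite (cnil_1 ct1) mulg1.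
- exact: subsetIl.
- move=> q /setIP[Pq]; rewrite !inE => /eqP tq; apply/andP; split.
    by have := tP _ Pq; rewrite inE.
  by rewrite /= tq (cnil_1 ct).
- move=> i [x y] /inP[z ->]; rewrite itt /= => /setIP[_]; rewrite inE /= => /eqP tx.
  (* Here [y'] is the defect of [f] on the [i]-th iterate and [z] that of [y] against [f x];
     dividing by the iterate of this witness moves the pair onto the graph of [f], into [D]. *)
  have [y' Dy'] := nf1 i x; exists (1, t1 (y'^-1 * z)).
    rewrite !inE /= (cnil_1 ct) eqxx andbT; apply/existsP.
    by exists (y'^-1 * z); rewrite f1 mul1g.
  rewrite itt inE /= (cnil1 ct) invg1 mul1g tx eqxx /= Dy'.
  rewrite !(cnilM ct1, cnil_iterM ct1) (cnilV ct1) (cnil_iterV ct1) -!iterSr.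
  set a := iter _ _ z; set b := iter _ _ y'; set e := iter _ _ (f x).
  have ca g : commute a g by apply: c1.
  have cb g : commute b g by apply: c1.
  by rewrite invMg invgK -mulgA [b * _]mulgA (cb e) -(ca (e * b)) mulKg.
move=> F [sDF sFP stF tiF FKP].
(* [F] is the graph of a function: its elements over [1] lie in [F :&: K], hence in [D], whose only
   element over [1] is [(1, 1)]. *)
have Finj x y y' : (x, y) \in F -> (x, y') \in F -> y = y'.
  move=> Fy Fy'; have Fq : (1, y^-1 * y') \in F.
    by have := groupM (groupVr Fy) Fy'; rewrite -(mulVg x).
  have: (1, y^-1 * y') \in D.
    apply: (subsetP tiF); rewrite inE Fq inE (subsetP sFP _ Fq) inE /=.
    by rewrite (cnil_1 ct).
  by rewrite inE /= f1 => /andP[_ /eqP/(canRL (mulKVg _))->]; rewrite mulg1.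
(* Totality comes from [F * K = P]: the factor in [K] lies over the kernel of [t] and is exchanged
   for the point of [D] with the same first coordinate. *)
have /fin_all_exists[h Fh] x : exists y, (x, y) \in F.
  have: (x, f x) \in (Group P_group : {set _}).
    by apply/inP; exists 1; rewrite (cnil_1 ct1) mulg1.
  rewrite -FKP => /mulsgP[[x1 y1] [x2 y2] Fq /setIP[_]]; rewrite inE /= => /eqP tx2.
  case=> -> _; exists (y1 * f x2).
  have Dx2 : (x2, f x2) \in F by apply: (subsetP sDF); rewrite inE /= tx2 !eqxx.
  exact: groupM Fq Dx2.
have hM : {morph h : x y / x * y}.
  by move=> x y; apply: (Finj (x * y)); rewrite ?Fh //; apply: (groupM (Fh x) (Fh y)).
have ht x : h (t x) = t1 (h x).
  by apply: (Finj (t x)); rewrite ?Fh //; apply: (stF _ (Fh x)).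
have h1 : h 1 = 1 by apply: (@mulgI _ (h 1)); rewrite -hM !mulg1.
have hV x : h x^-1 = (h x)^-1.
  by apply/eqP; rewrite eq_sym eq_invg_mul -hM mulgV h1.
exists h; split=> //; apply: inj_card_bij; last by rewrite eqX.
suff ker_h x : h x = 1 -> x = 1.
  move=> x y hxy; apply/eqP; rewrite eq_mulgV1; apply/eqP/ker_h.
  by rewrite hM hV hxy mulgV.
(* The kernel of [h] is stable under [t], and nilpotency reduces its triviality to the kernel of
   [t], where [h] agrees with [f]. *)
have: iter n t x = 1 by case: ct.
elim: (n) x => // k IHk x tkx hx1.
have tx1 : t x = 1 by apply: IHk; rewrite -?iterSr // ht hx1 (cnil_1 ct1).
have [_ fx1 _] := nf3 x tx1; apply: fx1; apply: (Finj x); last by rewrite -hx1 Fh.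
by apply: (subsetP sDF); rewrite inE /= tx1 !eqxx.
Qed.
End Lift.

(** * Twisting a group law by a carry *)

(** The proofs are parameters of the type so that the group structure can be inferred from the type
    alone. *)
Definition law_carrier (X : finType) (mul : X -> X -> X) (one : X) (inv : X -> X)
    (mulA : associative mul) (mul1 : left_id one mul)
    (mulV : left_inverse one inv mul) : Type := X.

Section LawGroup.
Variables (X : finType) (mul : X -> X -> X) (one : X) (inv : X -> X).
Hypotheses (mulA : associative mul) (mul1 : left_id one mul).
Hypothesis (mulV : left_inverse one inv mul).
HB.instance Definition _ := Finite.on (law_carrier mulA mul1 mulV).
HB.instance Definition _ :=
  Finite_isGroup.Build (law_carrier mulA mul1 mulV) mulA mul1 mulV.

Lemma finGroup_of_law :
  exists (T : finGroupType) (f : X -> T) (g : T -> X),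
    [/\ cancel f g, cancel g f & forall x y, f x * f y = f (mul x y)].
Proof. by exists (law_carrier mulA mul1 mulV), id, id. Qed.
End LawGroup.

(** The cocycle identity of the carry, source of the associativity of the twisted law. *)
Lemma carry_assoc p a b : (a %/ p + (a %% p + b) %/ p = (a + b) %/ p)%N.
Proof.
have [-> | p_gt0] := posnP p; first by rewrite !divn0.
by rewrite {3}(divn_eq a p) -addnA divnMDl.
Qed.

(** A homomorphism to Z/p, valued in digits so that carries can be formed. *)
Definition pcharacter p (X : finGroupType) (chi : X -> nat) :=
  (forall x, chi x < p) /\ (forall x y, chi (x * y) = (chi x + chi y) %% p).

Section Pcharacter.
Variables (p : nat) (X : finGroupType) (chi : X -> nat).
Hypothesis chiP : pcharacter p chi.

Lemma pchar_lt x : chi x < p. Proof. by case: chiP. Qed.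
Lemma pcharM x y : chi (x * y) = ((chi x + chi y) %% p)%N. Proof. by case: chiP. Qed.
Lemma pchar_small x : (chi x %% p)%N = chi x. Proof. exact: modn_small (pchar_lt x). Qed.

Lemma pcharMl x y : chi y = 0%N -> chi (x * y) = chi x.
Proof. by move=> y0; rewrite pcharM y0 addn0 pchar_small. Qed.

Lemma pchar_cancel x y : chi (x * y) = chi x -> chi y = 0%N.
Proof.
move/eqP; rewrite pcharM -{2}(pchar_small x) -[X in _ == X %[mod _]]addn0 eqn_modDl mod0n.
by rewrite pchar_small => /eqP.
Qed.

Lemma pchar1 : chi 1 = 0%N. Proof. by apply: (@pchar_cancel 1); rewrite mulg1. Qed.

Lemma pchar_comm x y : chi [~ x, y] = 0%N.
Proof. by apply: (@pchar_cancel (y * x)); rewrite -commgC !pcharM addnC. Qed.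

Lemma pcharX x k : chi (x ^+ k) = ((k * chi x) %% p)%N.
Proof.
elim: k => [|k IHk]; first by rewrite pchar1 mod0n.
by rewrite expgS pcharM IHk modnDmr mulSn.
Qed.

Lemma pcharX0 x k : chi x = 0%N -> chi (x ^+ k) = 0%N.
Proof. by move=> x0; rewrite pcharX x0 muln0 mod0n. Qed.

End Pcharacter.

(* The law [x * y * z ^+ carry] adds to the [p]-power map the factor [z ^+ chi x]. *)
Lemma twist p (X : finGroupType) (chi : X -> nat) (z : X) : prime p ->
    pcharacter p chi -> (forall x, commute z x) -> chi z = 0%N ->
  exists (X1 : finGroupType) (f : X -> X1) (g : X1 -> X),
    [/\ [/\ cancel f g, cancel g f &
         forall x y, f x * f y = f (x * y * z ^+ ((chi x + chi y) %/ p))],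
        forall x, f x ^+ p = f (x ^+ p * z ^+ chi x)
      & forall x y, f [~ x, y] = [~ f x, f y]].
Proof.
move=> p_pr chiP zC chiz; have p_gt0 := prime_gt0 p_pr.
have zXC k x : commute (z ^+ k) x by apply/commute_sym/commuteX/commute_sym/zC.
have chi_z x k : chi (x * z ^+ k) = chi x by rewrite (pcharMl chiP) // (pcharX0 chiP).
have zr u k w : u * z ^+ k * w = u * w * z ^+ k by rewrite -mulgA zXC mulgA.
have zz u k l : u * z ^+ k * z ^+ l = u * z ^+ (k + l) by rewrite expgD mulgA.
pose mul x y := x * y * z ^+ ((chi x + chi y) %/ p).
have mulA : associative mul.
  move=> a b c; rewrite /mul !chi_z !(pcharM chiP).
  rewrite (zr (a * b)) !mulgA !zz.
  by rewrite [(chi a + _ %% p)%N]addnC !carry_assoc [(_ + chi a)%N]addnC addnA.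
have mul1 : left_id 1 mul.
  move=> x; rewrite /mul mul1g (pchar1 chiP) add0n divn_small ?mulg1 //.
  exact: pchar_lt chiP x.
pose inv x := x^-1 * z ^- ((chi x^-1 + chi x) %/ p).
have mulV : left_inverse 1 inv mul.
  move=> x; rewrite /mul /inv.
  have -> : chi (x^-1 * z ^- ((chi x^-1 + chi x) %/ p)) = chi x^-1.
    by rewrite -[in RHS](mulgKV (z ^+ ((chi x^-1 + chi x) %/ p)) x^-1) chi_z.
  by rewrite -!mulgA -zXC mulKg mulVg.
have [X1 [f [g [fK gK fM]]]] := finGroup_of_law mulA mul1 mulV.
exists X1, f, g; split=> // [x | x y].
  have f1 : f 1 = 1 by apply: (@mulgI _ (f 1)); rewrite fM /mul (pchar1 chiP) div0n !mulg1.
  (* The carries of [k] equal digits add up to the quotient of [k * chi x] by [p], which is [chi x]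
     when [k = p]. *)
  have fX k : f x ^+ k = f (x ^+ k * z ^+ ((k * chi x) %/ p)).
    elim: k => [|k IHk]; first by rewrite mul0n div0n mulg1 f1.
    rewrite !expgSr IHk fM /mul chi_z (pcharX chiP) zr zz.
    by rewrite carry_assoc mulSn addnC.
  by rewrite fX mulnC mulnK.
(* The products [x y] and [y x] have the same carry, and a commutator, having digit [0], creates
   none. *)
apply: (@mulgI _ (f y * f x)); rewrite -commgC !fM /mul chi_z (pchar_comm chiP) addn0.
by rewrite (divn_small (pchar_lt chiP (y * x))) mulg1 zr -commgC addnC.
Qed.

(** * Twisting along a flag *)

(** Abstract form of the images of the powers of [t], so that [twist_down] can carry it over to a
    twisted group. *)
Definition chain N (X : finGroupType) (S : nat -> {group X}) :=
  [/\ S 0 = [set: X] :> {set X}, forall i, S i.+1 \subset S i,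
      forall i x y, x \in S i.+1 -> commute x y & S N = 1 :> {set X}].

Definition compat (X : finGroupType) (S : nat -> {group X}) (U : {group X}) :=
  U \subset S 1%N /\ forall i, U \subset S i \/ S i \subset U.

(* [dig u] is the class of [u] in the group [U / V] of order [p] generated by [z]. *)
Lemma flag_step p N (X : finGroupType) (S : nat -> {group X}) (U : {group X}) :
    prime p -> chain N S -> (forall i x, x \in S i -> x ^+ p \in S i.+1) ->
    compat S U -> U != 1 :> {set X} ->
  exists (V : {group X}) (z : X) (dig : X -> nat),
   [/\ [/\ V \subset U, #|V| < #|U|, z \in U & z \notin V],
       forall j, S j \subset V \/ U \subset S j,
       exists2 i, U \subset S i & S i.+1 \subset V
     & [/\ forall u, dig u < p, {in U, forall u, u * z ^- dig u \in V},
           {in U &, forall u v, dig (u * v) = ((dig u + dig v) %% p)%N}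
         & {in V, forall v, dig v = 0%N}]].
Proof.
move=> p_pr [S0 Sdec Scen SN] Spow [US1 cmpU] ntU.
have Sle i j : i <= j -> S j \subset S i.
  move/subnKC <-; elim: (_ - _)%N => [|k IHk]; rewrite ?addn0 // addnS.
  exact: subset_trans (Sdec _) IHk.
(* The index [i] obtained below is the last level containing [U]; [V] is then chosen maximal in [U]
   above [S i.+1]. *)
have exj : exists j, ~~ (U \subset S j).
  by exists N; rewrite SN subG1.
have [j0 nUj0 minj0] := ex_minnP exj.
have [i Dj0] : exists i, j0 = i.+1.
  by case: (j0) nUj0 => [|i _]; [rewrite S0 subsetT | exists i].
rewrite {j0}Dj0 in nUj0 minj0.
have USi : U \subset S i by apply: contraT => /minj0; rewrite ltnn.
have SiU : S i.+1 \subset U by case: (cmpU i.+1) nUj0 => // ->.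
have [SiEU | [V maxV SiV]] := maximal_exists SiU.
  by rewrite -SiEU subxx in nUj0.
have [prVU maxU] := maxgroupP maxV; have [sVU nUV] := andP prVU.
have [z Uz nVz] := subsetPn nUV.
have cUU x y : x \in U -> commute x y by move=> /(subsetP US1); apply: Scen.
have zpV : z ^+ p \in V by rewrite (subsetP SiV) ?Spow // (subsetP USi).
have VzU : V * <[z]> = U.
  rewrite -cent_joinEr; last first.
    by rewrite cycle_subG; apply/centP=> v _; apply: cUU.
  apply/eqP; rewrite eqEproper join_subG sVU cycle_subG Uz /=.
  apply: contra nVz => /maxU/= <-; last exact: joing_subl.
  by rewrite (subsetP (joing_subr _ _)) ?cycle_id.
have uniq a b u : a <= b -> b < p -> u * z ^- a \in V -> u * z ^- b \in V -> a = b.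
  move=> le_ab lt_bp Va Vb; apply/eqP; apply: contraR nVz => neq_ab.
  have lt_ab : a < b by rewrite ltn_neqAle neq_ab.
  apply: (@coprime_expg_mem _ V z p (b - a)); rewrite ?prime_gt0 //.
    rewrite prime_coprime // gtnNdvd ?subn_gt0 //.
    exact: leq_ltn_trans (leq_subr _ _) lt_bp.
  have -> : z ^+ (b - a) = (u * z ^- b)^-1 * (u * z ^- a).
    by rewrite -{2}(subnK le_ab) expgD !invMg !invgK -!mulgA mulKg mulgV mulg1.
  by rewrite groupM ?groupV.
(* The default [0] is taken exactly outside [U]. *)
pose dig u := if [pick k : 'I_p | u * z ^- k \in V] is Some k then nat_of_ord k else 0%N.
have dig_lt u : dig u < p by rewrite /dig; case: pickP => [k _ |_]; rewrite ?prime_gt0.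
have digP u : u \in U -> u * z ^- dig u \in V.
  rewrite -{1}VzU => /mulsgP[v _ Vv /cycleP[k ->] ->].
  rewrite /dig; case: pickP => [// | /(_ (Ordinal (ltn_pmod k (prime_gt0 p_pr))))] /= /negP[].
  by rewrite {1}(divn_eq k p) expgD -!mulgA mulgV mulg1 mulnC expgM groupM // groupX.
have dig_uniq u k : u \in U -> k < p -> u * z ^- k \in V -> dig u = k.
  move=> Uu lt_kp Vk; have Vd := digP u Uu.
  have [le | /ltnW le] := leqP (dig u) k; first exact: uniq le lt_kp Vd Vk.
  exact: esym (uniq _ _ _ le (dig_lt u) Vk Vd).
exists V, z, dig; split=> //.
- by split=> //; apply: proper_card.
- move=> j; have [le_ji | lt_ij] := leqP j i.
    by right; apply: subset_trans (Sle _ _ le_ji).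
  by left; apply: subset_trans (Sle _ _ lt_ij) SiV.
- by exists i.
split=> // [u v Uu Uv | v Vv].
  apply: dig_uniq; [exact: groupM | by rewrite ltn_pmod ?prime_gt0 |].
  have -> : u * v * z ^- ((dig u + dig v) %% p) =
     u * z ^- dig u * (v * z ^- dig v) * (z ^+ p) ^+ ((dig u + dig v) %/ p).
    rewrite -expgM mulnC; apply: (canLR (mulgK _)).
    rewrite -mulgA -expgD -divn_eq addnC expgD -!mulgA; congr (_ * _).
    have zC k x : commute (z ^+ k) x by apply/commute_sym/commuteX/commute_sym/cUU.
    by rewrite mulKg -zC mulKg.
  by apply: groupM (groupM _ _) (groupX _ zpV); apply: digP.
by apply: dig_uniq; rewrite ?prime_gt0 ?(subsetP sVU) // invg1 mulg1.
Qed.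

(* The law of [X'] is read on [X] through the bijection [f] with inverse [g]: it differs from
   that of [X] by terms of [U] one step deeper in the chain [S], and [t'] agrees with [t]
   up to terms one step deeper than expected. *)
Definition shadow (X X' : finGroupType) (S : nat -> {group X}) (U : {group X})
    (t : X -> X) (t' : X' -> X') (f : X -> X') (g : X' -> X) :=
  [/\ cancel f g /\ cancel g f,
      forall i x y, y \in S i -> (x * y)^-1 * g (f x * f y) \in U :&: S i.+1,
      forall x b, t b = 1 -> f (x * b) = f x * f b,
      forall x y, f [~ x, y] = [~ f x, f y]
    & [/\ forall i x, x \in S i -> (t x)^-1 * g (t' (f x)) \in S i.+2,
          forall x, g (t' (f x)) \in U
        & forall x, t x = 1 <-> t' (f x) = 1]].

(** * Computing in a transported law *)

Section TransportedLaw.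
Variables (N : nat) (X X' : finGroupType) (S : nat -> {group X}) (U : {group X}).
Variables (f : X -> X') (g : X' -> X).
Hypotheses (chS : chain N S) (fK : cancel f g) (gK : cancel g f).
Hypothesis fM : forall i x y, y \in S i -> (x * y)^-1 * g (f x * f y) \in U :&: S i.+1.
Hypothesis fR : forall x y, f [~ x, y] = [~ f x, f y].

Lemma lawP i x y : y \in S i ->
  exists2 s, s \in U :&: S i.+1 & g (f x * f y) = x * y * s.
Proof. by move=> /(fM x) Us; exists ((x * y)^-1 * g (f x * f y)); rewrite ?mulKVg. Qed.

Lemma law1 : f 1 = 1. Proof. by rewrite -(commgg 1) fR commgg. Qed.

Lemma law_central z : (forall x, commute z x) -> forall x, commute (f z) x.
Proof.
move=> zC x; apply/commgP; rewrite -[x]gK -fR.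
by have /commgP/eqP-> := zC (g x); rewrite law1.
Qed.

(** As [z] already lies in [S i.+1], each multiplication errs only in [S i.+2], and these errors are
    central. *)
Lemma lawX i z k : z \in S i.+1 -> exists2 s, s \in U :&: S i.+2 & g (f z ^+ k) = z ^+ k * s.
Proof.
have [_ _ Scen _] := chS; move=> Sz; elim: k => [|k [s Us IHk]].
  by exists 1; rewrite ?group1 // !expg0 -{1}law1 fK mulg1.
have [s' Us' Ds'] := lawP (g (f z ^+ k)) Sz; exists (s * s'); first exact: groupM.
rewrite expgSr -[f z ^+ k]gK Ds' IHk expgSr -!mulgA; congr (_ * _).
by rewrite !mulgA (Scen _ _ s Sz).
Qed.
End TransportedLaw.

(* The part of [t] with values in a subgroup [V] of [U] is realised first; then the last
   digit [chi] of [t] is still a character and allows one more twist. *)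
Theorem twist_up p N (X : finGroupType) (S : nat -> {group X}) (U : {group X}) (t : X -> X) :
    prime p -> chain N S -> (forall x : X, x ^+ p = 1) -> compat S U ->
    {morph t : x y / x * y} -> (forall x, t x \in U) ->
    (forall i x, x \in S i -> t x \in S i.+1) ->
  exists (X' : finGroupType) (f : X -> X') (g : X' -> X),
    shadow S U t (fun x => x ^+ p) f g.
Proof.
move=> p_pr chS expX; have [S0 Sdec Scen SN] := chS; have p_gt0 := prime_gt0 p_pr.
have inS0 x : x \in S 0 by rewrite S0 inE.
have [n] := ubnP #|U|; elim: n U t => // n IHn U t lt_n cmpU tM tU tS.
have [U1 | ntU] := eqVneq (U : {set X}) 1.
  have t1 x : t x = 1 by apply/set1P; rewrite -[[set 1]]U1.
  exists X, id, id; split=> //.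
    by move=> i x y _; rewrite mulVg group1.
  by split=> [i x _ | x | x]; rewrite !expX ?t1 ?invg1 ?mulg1 ?group1.
have Spow i x : x \in S i -> x ^+ p \in S i.+1 by rewrite expX group1.
have [V [z [dig [[sVU ltVU Uz nVz] SVU [i0 USi SiV]]]]] := flag_step p_pr chS Spow cmpU ntU.
case=> dig_lt digV digM dig0.
have [US1 _] := cmpU.
have cmpV : compat S V.
  split=> [|j]; first exact: subset_trans US1.
  by case: (SVU j) => [|UV]; [right | left; apply: subset_trans UV].
have cU u y : u \in U -> commute u y by move=> /(subsetP US1); apply: Scen.
have tUV x : x \in U -> t x \in V by move=> /(subsetP USi)/tS; apply: subsetP.
(* The last digit of [t] vanishes on [U], because [t] sends [U] into [S i0.+1] and so into [V]. *)
pose chi x := dig (t x).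
have chi0 x : x \in U -> chi x = 0%N by move=> /tUV/dig0.
have chiP : pcharacter p chi.
  by split=> [x | x y]; rewrite /chi // tM digM.
pose t' x := t x * z ^- chi x.
have zM k x : commute (z ^+ k) x by apply: cU; rewrite groupX.
have t'M : {morph t' : x y / x * y}.
  move=> x y; rewrite /t' tM (pcharM chiP) expg_mod // expgD invMg.
  rewrite -!mulgA; congr (_ * _); rewrite mulgA.
  by apply/esym; apply: cU; rewrite groupV groupX.
have t'V x : t' x \in V by apply: digV.
(* On [S i] either the digit is zero or [z] is deep enough for corrections by its powers to stay in
   [S i.+1]. *)
have Schi i x : x \in S i -> chi x = 0%N \/ z \in S i.+1.
  move=> Sx; have [SV | US] := SVU i.+1; last by right; apply: subsetP Uz.
  by left; apply: dig0; apply: subsetP (tS _ _ Sx).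
have t'S i x : x \in S i -> t' x \in S i.+1.
  move=> Sx; rewrite /t' groupM ?tS // groupV.
  by have [-> | Sz] := Schi _ _ Sx; rewrite ?group1 ?groupX.
have lt_V : #|V| < n by apply: leq_trans ltVU _.
have [X1 [f [g [[fK gK] fM fB fR [fT fTV fT1]]]]] := IHn V t' lt_V cmpV t'M t'V t'S.
have lawX1 := lawX chS fK gK fM fR.
have f1 := law1 fR.
pose chi1 a := chi (g a).
have chi1P : pcharacter p chi1.
  split=> [a | a b]; rewrite /chi1 ?(pchar_lt chiP) //.
  have [s /setIP[Vs _]] := lawP fM (g a) (inS0 (g b)); rewrite !gK => ->.
  by rewrite (pcharMl chiP) ?(pcharM chiP) // chi0 // (subsetP sVU).
have fzC : forall x, commute (f z) x by apply: law_central => // x; apply: cU.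
(* This twist multiplies the p-power map of [X1] by a power of [f z] and so restores the removed
   digit. *)
have [|X2 [f2 [g2 [[f2K g2K f2M] f2X f2R]]]] := twist p_pr chi1P fzC.
  by rewrite /chi1 fK chi0.
have f21 : f2 1 = 1 by rewrite -(commgg 1) f2R commgg.
have f2inj : injective f2 by apply: can_inj f2K.
exists X2, (f2 \o f), (g \o g2); split=> [|i x y Sy|x b tb|x y|] /=.
- by split; apply: can_comp.
- rewrite f2M f2K /chi1 !fK; set c := (_ %/ p)%N.
  have [s Us Ds] := lawP fM x Sy.
  have [chiy | Sz] := Schi _ _ Sy.
    rewrite /c chiy addn0 divn_small ?(pchar_lt chiP) // mulg1 Ds mulKg.
    exact: subsetP (setSI _ sVU) _ Us.
  have [e Ve De] := lawX1 _ _ c Sz.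
  have Se : g (f z ^+ c) \in S i.+1.
    rewrite De groupM ?groupX //; apply: subsetP (Sdec _) _ _.
    by case/setIP: Ve.
  have [s2 Us2] := lawP fM (g (f x * f y)) Se; rewrite !gK Ds => ->.
  rewrite -!(mulgA (x * y)) mulKg.
  have [[Vs2 Ss2] [Ve' _]] := (setIP Us2, setIP Ve).
  have UIs : s \in U :&: S i.+1 by apply: subsetP (setSI _ sVU) _ Us.
  apply: groupM (groupM UIs _) _; rewrite inE.
    by rewrite Se andbT De groupM ?groupX // (subsetP sVU).
  by rewrite (subsetP sVU) //=; apply: subsetP (Sdec _) _ Ss2.
- have chib : chi b = 0%N by rewrite /chi tb dig0.
  rewrite f2M /chi1 !fK chib addn0 divn_small ?(pchar_lt chiP) // mulg1.
  by rewrite fB // /t' tb chib invg1 mulg1.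
- by rewrite fR f2R.
split=> [i x Sx | x | x] /=.
- rewrite f2X f2K /chi1 fK.
  have Sw := fT i x Sx; set w := g (f x ^+ p) in Sw.
  have [chix | Sz] := Schi _ _ Sx.
    by move: Sw; rewrite /t' chix expg0 invg1 mulg1 mulg1.
  have [e /setIP[_ Se] De] := lawX1 _ _ (chi x) Sz.
  have Se' : g (f z ^+ chi x) \in S i.+1.
    by rewrite De groupM ?groupX //; apply: subsetP (Sdec _) _ Se.
  have [s2 /setIP[_ Ss2]] := lawP fM w Se'; rewrite !gK De => ->.
  have -> : (t x)^-1 * (w * (z ^+ chi x * e) * s2) = (t' x)^-1 * w * (e * s2).
    rewrite /t' invMg invgK (zM _ (t x)^-1) -!mulgA; congr (_ * _).
    by rewrite !mulgA -(zM _ w).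
  exact: groupM Sw (groupM Se Ss2).
- rewrite f2X f2K /chi1 fK; set w := g (f x ^+ p).
  have Vw : w \in V by apply: fTV.
  have [e /setIP[Ve _] De] := lawX1 0%N _ (chi x) (subsetP US1 _ Uz).
  have [s2 /setIP[Vs2 _]] := lawP fM w (inS0 (g (f z ^+ chi x))); rewrite !gK De => ->.
  by rewrite !groupM ?groupX // (subsetP sVU).
rewrite f2X /chi1 fK; split=> [tx1 | fx1].
  have chix : chi x = 0%N by rewrite /chi tx1 dig0.
  have /fT1-> : t' x = 1 by rewrite /t' tx1 chix invg1 mulg1.
  by rewrite chix mulg1 f21.
have {fx1} : f x ^+ p * f z ^+ chi x = 1 by apply: f2inj; rewrite f21.
set w := g (f x ^+ p) => fx1.
(* A nonzero digit would put [z ^+ chi x] in [V], and [z] with it since [z ^+ p = 1]. *)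
have chix : chi x = 0%N.
  have Vw : w \in V by apply: fTV.
  have [e /setIP[Ve _] De] := lawX1 0%N _ (chi x) (subsetP US1 _ Uz).
  have [s2 /setIP[Vs2 _]] := lawP fM w (inS0 (g (f z ^+ chi x))); rewrite !gK fx1 De.
  rewrite -f1 fK => Dz; apply/eqP; apply: contraR nVz => nz.
  apply: (@coprime_expg_mem _ V z p (chi x)); rewrite ?expX //.
    by rewrite prime_coprime // gtnNdvd ?lt0n ?(pchar_lt chiP).
  have: w * (z ^+ chi x * e) * s2 \in V by rewrite -Dz group1.
  by rewrite groupMr // groupMl // groupMr.
have fx1' : f x ^+ p = 1 by rewrite chix mulg1 in fx1.
by have := (fT1 x).2 fx1'; rewrite /t' chix invg1 mulg1.
Qed.

(* Untwisting goes in the opposite order: the top digit of the [p]-power map is removed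
   first, and the endomorphism [t] is rebuilt once the exponent is [p]. *)
Theorem twist_down p N (X : finGroupType) (S : nat -> {group X}) (U : {group X}) :
    prime p -> chain N S -> compat S U ->
    {morph (fun x : X => x ^+ p) : x y / x * y} -> (forall x, x ^+ p \in U) ->
    (forall i x, x \in S i -> x ^+ p \in S i.+1) ->
  exists (E : finGroupType) (f : X -> E) (g : E -> X) (t : E -> E),
    [/\ {morph t : x y / x * y}, forall x : E, x ^+ p = 1
      & shadow S U (fun x => x ^+ p) t f g].
Proof.
move=> p_pr; have p_gt0 := prime_gt0 p_pr.
have [n] := ubnP #|U|; elim: n X S U => // n IHn X S U lt_n chS cmpU pM pU pS.
have [S0 Sdec Scen SN] := chS.
have inS0 x : x \in S 0 by rewrite S0 inE.
have [U1 | ntU] := eqVneq (U : {set X}) 1.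
  have p1 (x : X) : x ^+ p = 1 by apply/set1P; rewrite -[[set 1]]U1.
  exists X, id, id, (fun=> 1); split=> //; first by move=> x y; rewrite mulg1.
  split=> //; first by move=> i x y _; rewrite mulVg group1.
  by split=> [i x _ | x | x]; rewrite ?p1 ?invg1 ?mulg1 ?group1.
have [V [z [dig [[sVU ltVU Uz nVz] SVU [i0 USi SiV]]]]] := flag_step p_pr chS pS cmpU ntU.
case=> dig_lt digV digM dig0.
have [US1 _] := cmpU.
have cU u y : u \in U -> commute u y by move=> /(subsetP US1); apply: Scen.
have pUV x : x \in U -> x ^+ p \in V by move=> /(subsetP USi)/pS; apply: subsetP.
pose chi x := dig (x ^+ p).
have chi0 x : x \in U -> chi x = 0%N by move=> /pUV/dig0.
have chiP : pcharacter p chi.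
  by split=> [x | x y]; rewrite /chi // pM digM.
have chi_lt x : chi x < p by apply: pchar_lt chiP x.
have chi_div x : (chi x %/ p = 0)%N by apply: divn_small.
have zC k x : commute (z^-1 ^+ k) x by apply: cU; rewrite groupX ?groupV.
have Schi i x : x \in S i -> chi x = 0%N \/ z \in S i.+1.
  move=> Sx; have [SV | US] := SVU i.+1; last by right; apply: subsetP Uz.
  by left; apply: dig0; apply: subsetP (pS _ _ Sx).
(* Twisting by [z^-1] cancels the last digit, so that all p-powers in [X1] fall in the image of
   [V]. *)
have [x||X1 [f1 [g1 [[f1K g1K f1M] f1X f1R]]]] := @twist p X chi z^-1 p_pr chiP.
- exact: (zC 1%N).
- by rewrite chi0 ?groupV.
have f11 : f1 1 = 1 by rewrite -(commgg 1) f1R commgg.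
have f1inj : injective f1 by apply: can_inj f1K.
have f1M0 x y : chi y = 0%N -> f1 x * f1 y = f1 (x * y).
  by move=> y0; rewrite f1M y0 addn0 chi_div mulg1.
(* Generation only supplies a group structure; [imGE] recovers the plain image when [H] absorbs the
   carries. *)
pose imG (H : {group X}) := <<[set f1 x | x in H]>>%G.
have imGE (H : {group X}) :
    {in H &, forall x y, x * y * z^-1 ^+ ((chi x + chi y) %/ p) \in H} ->
  imG H = f1 @: H :> {set X1}.
  move=> HM; apply: gen_set_id; apply/group_setP; split.
    by apply/imsetP; exists 1; rewrite ?group1.
  move=> _ _ /imsetP[x Hx ->] /imsetP[y Hy ->]; rewrite f1M; apply: imset_f.
  exact: HM.
have zS i x y : y \in S i -> z^-1 ^+ ((chi x + chi y) %/ p) \in U :&: S i.+1.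
  move=> Sy; have [-> | Sz] := Schi _ _ Sy; first by rewrite addn0 chi_div group1.
  by rewrite groupX // inE !groupV Uz.
pose S1 i := imG (S i).
have S1E i : S1 i = f1 @: S i :> {set X1}.
  apply: imGE => x y Sx Sy; rewrite !groupM //.
  by have /setIP[_ /(subsetP (Sdec i))] := zS i x y Sy.
pose V1 := imG V.
have V1E : V1 = f1 @: V :> {set X1}.
  apply: imGE => x y Vx Vy; rewrite (chi0 y) ?(subsetP sVU) // addn0 chi_div mulg1.
  exact: groupM.
have inS1 i x : (f1 x \in S1 i) = (x \in S i) by rewrite S1E mem_imset.
have inV1 x : (f1 x \in V1) = (x \in V) by rewrite V1E mem_imset.
have chS1 : chain N S1.
  split=> [|i|i x y|].
  - by apply/setP=> y; rewrite -[y]g1K inS1 inS0 inE.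
  - by rewrite !S1E imsetS.
  - rewrite S1E => /imsetP[s Ss ->]; apply/commgP.
    by rewrite -[y]g1K -f1R; have /commgP/eqP-> := Scen _ _ (g1 y) Ss; rewrite f11.
  - by rewrite S1E SN imset_set1 f11.
have cmpV1 : compat S1 V1.
  split=> [|j]; first by rewrite S1E V1E imsetS // (subset_trans sVU).
  rewrite S1E V1E; have [SV | US] := SVU j; first by right; rewrite imsetS.
  by left; rewrite imsetS // (subset_trans sVU).
have xpV x : x ^+ p * z^-1 ^+ chi x \in V by rewrite expgVn; apply: digV.
have chi_z w k : chi (w * z^-1 ^+ k) = chi w.
  by rewrite (pcharMl chiP) // chi0 ?groupX ?groupV.
have pM1 : {morph (fun x : X1 => x ^+ p) : x y / x * y}.
  move=> a b /=; rewrite -[a]g1K -[b]g1K; move: (g1 a) (g1 b) => x y.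
  rewrite f1M !f1X f1M0; last by rewrite chi0 // (subsetP sVU).
  congr f1; rewrite chi_z !pM (pcharM chiP) -expgM -mulgA -expgD -divn_eq expgD.
  by rewrite -!mulgA; congr (_ * _); rewrite mulgA [RHS]mulgA (zC _ (y ^+ p)).
have pV1 (a : X1) : a ^+ p \in V1 by rewrite -[a]g1K f1X inV1.
have xpS i x : x \in S i -> x ^+ p * z^-1 ^+ chi x \in S i.+1.
  move=> Sx; rewrite groupM ?pS //.
  by have [-> | Sz] := Schi _ _ Sx; rewrite ?group1 ?groupX ?groupV.
have pS1 i (a : X1) : a \in S1 i -> a ^+ p \in S1 i.+1.
  by rewrite -[a]g1K f1X !inS1; apply: xpS.
have lt_V1 : #|V1| < n.
  by rewrite V1E card_imset //; apply: leq_trans ltVU _.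
have [E [f2 [g2 [t2 [t2M expE]]]]] := IHn X1 S1 V1 lt_V1 chS1 cmpV1 pM1 pV1 pS1.
case=> [[f2K g2K] f2M f2B f2R [f2T f2TV f2T1]].
have f2M' i x y : y \in S i -> exists2 v, v \in V :&: S i.+1 &
    g2 (f2 (f1 x) * f2 (f1 y)) = f1 (x * y * z^-1 ^+ ((chi x + chi y) %/ p) * v).
  rewrite -inS1 => /(lawP f2M (f1 x))[v1 /setIP[]].
  rewrite -[v1]g1K inV1 inS1 => Vv Sv ->; exists (g1 v1); first by rewrite inE Vv.
  by rewrite f1M f1M0 // chi0 // (subsetP sVU).
pose f := f2 \o f1; pose g := g1 \o g2.
have fK : cancel f g by apply: can_comp.
have gK : cancel g f by apply: can_comp.
have fR x y : f [~ x, y] = [~ f x, f y] by rewrite /f /= f1R f2R.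
have fM i x y : y \in S i -> (x * y)^-1 * g (f x * f y) \in U :&: S i.+1.
  move=> Sy; have [v /setIP[Vv Sv]] := f2M' i x y Sy; rewrite /g /f /= => ->.
  rewrite f1K -!(mulgA (x * y)) mulKg; apply: groupM (zS _ _ _ Sy) _.
  by rewrite inE Sv (subsetP sVU).
have f1' := law1 fR.
have fzC x : commute (f z) x by apply: law_central => // y; apply: cU.
have fzXC k x : commute (f z ^+ k) x by apply/commute_sym/commuteX/commute_sym/fzC.
pose chi' a := chi (g a).
have chi'P : pcharacter p chi'.
  split=> [a | a b]; rewrite /chi' //.
  have [v /setIP[Vv _]] := f2M' 0%N (g a) (g b) (inS0 _).
  rewrite -[f2 (f1 (g a))]/(f (g a)) -[f2 (f1 (g b))]/(f (g b)) !gK => Dab.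
  rewrite -[g (a * b)]/(g1 (g2 (a * b))) Dab f1K (pcharMl chiP) ?chi_z ?(pcharM chiP) //.
  by rewrite chi0 // (subsetP sVU).
(* The digit cancelled by the first twist returns as a factor of the endomorphism. *)
pose t a := t2 a * f z ^+ chi' a.
have tM : {morph t : x y / x * y}.
  move=> a b; rewrite /t t2M (pcharM chi'P) expg_mod ?expE // expgD.
  by rewrite -!mulgA; congr (_ * _); rewrite !mulgA fzXC.
exists E, f, g, t; split=> //; split=> //.
- move=> x b bp1; have chib : chi b = 0%N by rewrite /chi bp1 dig0.
  rewrite /f /= -f1M0 // f2B // f1X chib bp1 mulg1 f11 //.
have t2E x : exists2 w, w \in V & t2 (f x) = f w.
  have := f2TV (f1 x); rewrite -[g2 _]g1K inV1 => Vw.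
  by exists (g1 (g2 (t2 (f x)))); rewrite // /f /= g1K g2K.
split=> [i x Sx | x | x] /=.
- pose w := g1 (g2 (t2 (f x))).
  have Dw : t2 (f x) = f w by rewrite /f /w /= g1K g2K.
  pose s := g1 ((f1 x ^+ p)^-1 * f1 w).
  have Ss : s \in S i.+2 by rewrite -inS1 /s /w !g1K; apply: f2T; rewrite inS1.
  have Dw2 : w = x ^+ p * z^-1 ^+ chi x * s.
    apply: f1inj; rewrite -(mulKVg (f1 x ^+ p) (f1 w)) -[_^-1 * _]g1K -/s f1X f1M.
    by rewrite (chi0 (_ * _)) ?(subsetP sVU) // add0n chi_div mulg1.
  rewrite /t /chi' fK Dw; have [chix | Sz] := Schi _ _ Sx.
    by rewrite chix mulg1 fK Dw2 chix mulg1 mulKg.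
  have [e /setIP[_ Se] De] := lawX chS fK gK fM fR (chi x) Sz.
  have Se' : g (f z ^+ chi x) \in S i.+1.
    by rewrite De groupM ?groupX //; apply: subsetP (Sdec _) _ Se.
  have [s2 /setIP[_ Ss2]] := lawP fM w Se'; rewrite gK De => ->.
  have -> : w * (z ^+ chi x * e) * s2 = x ^+ p * (s * e * s2).
    rewrite Dw2 expgVn -!mulgA; congr (_ * _).
    have zC' y : commute (z ^+ chi x) y by apply: cU; rewrite groupX.
    by rewrite (mulgA s) -(zC' s) -mulgA mulKg.
  by rewrite mulKg !groupM.
- have [w Vw Dw] := t2E x; rewrite /t /chi' fK Dw.
  have [e /setIP[Ue _] De] := lawX chS fK gK fM fR (chi x) (subsetP US1 _ Uz).
  have [s2 /setIP[Us2 _]] := lawP fM w (inS0 (g (f z ^+ chi x))); rewrite !gK De => ->.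
  by rewrite !groupM ?groupX // (subsetP sVU).
rewrite /t /chi' fK; split=> [xp1 | tx1].
  have chix : chi x = 0%N by rewrite /chi xp1 dig0.
  have /f2T1 : f1 x ^+ p = 1 by rewrite f1X xp1 chix mulg1 f11.
  by rewrite chix mulg1.
have [w Vw Dw] := t2E x.
(* The image of [V] in [E] is a subgroup, and replaces [V] in showing that the digit of [x]
   vanishes. *)
have fV_group : group_set (f @: V).
  apply/group_setP; split; first by rewrite -f1' imset_f.
  move=> _ _ /imsetP[u Vu ->] /imsetP[v Vv ->].
  have [s /setIP[Vs _] Ds] := f2M' 0%N u v (inS0 v).
  rewrite -[f u * f v]g2K Ds; apply: (imset_f f).
  by rewrite (chi0 v) ?addn0 ?chi_div ?mulg1 ?groupM // (subsetP sVU).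
have chix : chi x = 0%N.
  apply/eqP; apply: contraR nVz => nz; rewrite -(mem_imset V z (can_inj fK)).
  apply: (@coprime_expg_mem _ (Group fV_group) (f z) p (chi x)) => //.
  - by rewrite prime_coprime // gtnNdvd ?lt0n.
  - by rewrite expE; apply: (group1 (Group fV_group)).
  move: tx1; rewrite Dw => /(canRL (mulKg _)) ->; rewrite mulg1.
  by apply: (@groupVr _ (Group fV_group)); apply: imset_f.
move: tx1; rewrite chix mulg1 => /f2T1; rewrite f1X chix mulg1 -f11.
exact: f1inj.
Qed.

(** * From transported laws to near-homomorphisms *)

Section PowerChain.
Variables (n : nat) (X : finGroupType) (t : X -> X).
Hypothesis ct : cnil n t.

Definition image_chain i : {group X} := <<[set iter i t x | x : X]>>%G.

Lemma image_chainP i x : reflect (exists y, x = iter i t y) (x \in image_chain i).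
Proof.
rewrite /= gen_set_id; last first.
  apply/group_setP; split; first by apply/imsetP; exists 1; rewrite ?(cnil1 ct).
  move=> _ _ /imsetP[x' _ ->] /imsetP[y' _ ->]; rewrite -(cnil_iterM ct).
  exact: imset_f.
by apply: (iffP imsetP) => [[y _ ->] | [y ->]]; exists y.
Qed.

Lemma image_chainS i x : x \in image_chain i -> t x \in image_chain i.+1.
Proof. by move=> /image_chainP[y ->]; apply/image_chainP; exists y. Qed.

Lemma image_chain_chain : chain n image_chain.
Proof.
split=> [|i|i x y|].
- by apply/setP=> x; rewrite inE; apply/image_chainP; exists x.
- by apply/subsetP=> _ /image_chainP[y ->]; apply/image_chainP; exists (t y); rewrite -iterSr.
- by move=> /image_chainP[w ->]; apply: cnilC ct _ _.
apply/eqP; rewrite eqEsubset sub1G andbT; apply/subsetP=> _ /image_chainP[y ->].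
by case: ct => _ _ ->; apply: set11.
Qed.

Lemma image_chain_compat : compat image_chain (image_chain 1).
Proof.
have [S0 Sdec _ _] := image_chain_chain; split=> // -[|i]; first by left; rewrite S0 subsetT.
right; elim: i => // i; exact: subset_trans (Sdec _).
Qed.
End PowerChain.

Section ShadowNearhom.
Variables (n : nat) (X X' : finGroupType) (t : X -> X) (t' : X' -> X').
Variables (f : X -> X') (g : X' -> X).
Hypothesis ct : cnil n t.
Hypothesis t'M : {morph t' : x y / x * y}.
Let S := image_chain t.
Hypothesis sh : shadow S (S 1) t t' f g.

Let chS : chain n S := image_chain_chain ct.
Let fK : cancel f g. Proof. by case: sh => [[]]. Qed.
Let gK : cancel g f. Proof. by case: sh => [[]]. Qed.
Let fM : forall i x y, y \in S i -> (x * y)^-1 * g (f x * f y) \in S 1 :&: S i.+1.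
Proof. by case: sh. Qed.
Let fB : forall x b, t b = 1 -> f (x * b) = f x * f b. Proof. by case: sh. Qed.
Let fR : forall x y, f [~ x, y] = [~ f x, f y]. Proof. by case: sh. Qed.
Let fT : forall i x, x \in S i -> (t x)^-1 * g (t' (f x)) \in S i.+2.
Proof. by case: sh => _ _ _ _ []. Qed.
Let fTU : forall x, g (t' (f x)) \in S 1. Proof. by case: sh => _ _ _ _ []. Qed.
Let fT1 : forall x, t x = 1 <-> t' (f x) = 1. Proof. by case: sh => _ _ _ _ []. Qed.
Let Sdec i : S i.+1 \subset S i. Proof. by case: chS. Qed.
Let Scen i x y : x \in S i.+1 -> commute x y. Proof. by case: chS => _ _ /(_ i x y). Qed.
Let inS0 x : x \in S 0. Proof. by case: chS => -> *; rewrite inE. Qed.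
Let f1 : f 1 = 1 := law1 fR.

(* [s' |-> w^-1 * g (f w * f s')] is an injective self-map of the finite set [S j]. *)
Let coset_lift j w s : s \in S j -> exists2 s', s' \in S j & f (w * s) = f w * f s'.
Proof.
pose phi s' := w^-1 * g (f w * f s').
have phi_inj : injective phi.
  by move=> a b /mulgI/(can_inj gK)/mulgI/(can_inj fK).
have: phi @: S j == S j.
  rewrite eqEcard card_imset // leqnn andbT; apply/subsetP=> _ /imsetP[s' Ss' ->].
  have [e /setIP[_ Se]] := lawP fM w Ss'; rewrite /phi => ->.
  by rewrite -mulgA mulKg groupM // (subsetP (Sdec j)).
move/eqP=> Sphi; rewrite -{1}Sphi => /imsetP[s' Ss' ->]; exists s' => //.
by rewrite /phi mulKVg gK.
Qed.

Let fS_mul j a b : a \in S j -> b \in S j -> exists2 c, c \in S j & f a * f b = f c.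
Proof.
move=> Sa Sb; have [e /setIP[_ Se] De] := lawP fM a Sb.
exists (a * b * e); last by rewrite -De gK.
by rewrite !groupM // (subsetP (Sdec j)).
Qed.

Let fS_inv j a : a \in S j -> exists2 c, c \in S j & (f a)^-1 = f c.
Proof.
move=> Sa; have [c Sc] := @coset_lift j a a^-1 (groupVr Sa).
by rewrite mulgV f1 => /esym/eqP; rewrite -eq_invg_mul => /eqP; exists c.
Qed.

Let fTS j a : a \in S j -> exists2 c, c \in S j.+1 & t' (f a) = f c.
Proof.
move=> Sa; have Se := fT Sa; exists (g (t' (f a))); last by rewrite gK.
rewrite -(mulKVg (t a) (g _)) groupM //; first exact: (image_chainS ct).
exact: subsetP (Sdec _) _ Se.
Qed.

Let it'M i : {morph iter i t' : x y / x * y}.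
Proof. by move=> x y; elim: i => //= i ->; rewrite t'M. Qed.

(** Applying [t'] pushes the previous error one level deeper, and [coset_lift] turns the new error
    in [X] into a factor in [X']. *)
Let iter_approx j x : exists2 s, s \in S j.+1 & f (iter j t x) = iter j t' (f x) * f s.
Proof.
elim: j => [|j [s Ss IHj]]; first by exists 1; rewrite ?group1 // f1 mulg1.
have Su : iter j t x \in S j by apply/(image_chainP ct); exists x.
have Se := fT Su; set e := _^-1 * _ in Se.
have De : g (t' (f (iter j t x))) = t (iter j t x) * e by rewrite /e mulKVg.
have [s1 Ss1] := @coset_lift _ (t (iter j t x) * e) _ (groupVr Se).
rewrite mulgK -De gK IHj t'M /= => ->.
have [s2 Ss2 ->] := fTS Ss; have [s3 Ss3 Ds3] := fS_mul Ss2 Ss1.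
by exists s3; rewrite // -mulgA Ds3.
Qed.

Let iter_S i y : g (iter i t' y) \in S i.
Proof.
elim: i => [|i IHi]; first exact: inS0.
by have [c Sc] := fTS IHi; rewrite gK /= => ->; rewrite fK.
Qed.

(** Values of [t'] correspond to elements of the central [S 1], and [n] iterations lead into the
    trivial [S n]. *)
Lemma shadow_cnil : cnil n t'.
Proof.
split=> // [x y | x].
  rewrite -[x]gK -[t' _]gK; apply: (law_central gK fR) => z.
  exact: Scen (fTU _).
have [_ _ _ Sn] := chS; have := iter_S n x; rewrite Sn => /set1P gx1.
by rewrite -[LHS]gK gx1 f1.
Qed.
Let ct' := shadow_cnil.

(** Successive approximation: [iter_approx] leaves an error one level deeper, to which the argument
    applies again until the chain is trivial. *)
Let S_iter j s : s \in S j -> exists y, f s = iter j t' y.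
Proof.
have [m le_nm] : exists m, n <= m + j by exists n; apply: leq_addr.
elim: m j s le_nm => [|m IHm] j s le_nm Ss.
  case/(image_chainP ct): Ss => x ->; rewrite (@cnil_iter_le _ t n) //; last by case: ct.
  by exists 1; rewrite (cnil1 ct') f1.
case/(image_chainP ct): Ss => x ->; have [s' Ss' ->] := iter_approx j x.
have [|y ->] := IHm j.+1 s' _ Ss'; first by rewrite addnS.
by exists (f x * t' y); rewrite it'M -iterSr.
Qed.

(** Errors in the chain are values of iterates: of [t'] by [S_iter], of [t] by construction of the
    chain. *)
Theorem shadow_nearhom : nearhom t t' f /\ nearhom t' t g.
Proof.
split; split.
- move=> i x; have [s Ss ->] := iter_approx i x; have [y ->] := S_iter Ss.
  by exists y.
- move=> x y; have [s /setIP[_ Ss] Ds] := lawP fM x (inS0 y).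
  have [s' Ss'] := @coset_lift _ (x * y * s) _ (groupVr Ss).
  by rewrite mulgK -Ds gK => ->; have [z ->] := S_iter Ss'; exists z.
- move=> b tb; split=> [|fb|x]; [exact/fT1 | | exact: fB].
  by rewrite -[b]fK fb -f1 fK.
- exact: fR.
- move=> i y; have [s Ss] := iter_approx i (g y); rewrite gK => Dy.
  have [s2 Ss2 Ds2] := fS_inv Ss.
  have {}Dy : iter i t' y = f (iter i t (g y)) * f s2 by rewrite Dy -Ds2 mulgK.
  have [s3 /setIP[_ Ss3] Ds3] := lawP fM (iter i t (g y)) Ss2.
  have /(image_chainP ct)[w Dw] : s2 * s3 \in S i.+1.
    by rewrite groupM // (subsetP (Sdec _)).
  by exists w; rewrite Dy Ds3 -Dw mulgA.
- move=> a b; have [s /setIP[_ /(image_chainP ct)[w Dw]]] := lawP fM (g a) (inS0 (g b)).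
  by rewrite !gK => ->; exists w; rewrite Dw.
- move=> b t'b; have tb : t (g b) = 1 by apply/fT1; rewrite gK.
  split=> // [gb1 | x]; first by rewrite -[b]gK gb1 f1.
  by apply: (can_inj fK); rewrite fB // !gK.
- by move=> a b; apply: (can_inj fK); rewrite fR !gK.
Qed.
End ShadowNearhom.

(** * Matching and counting *)

Definition ppow p (X : finGroupType) (x : X) := x ^+ p.

(** The two maps need not be mutually inverse; having both directions lets objects with a common
    partner be linked by composition. *)
Definition matched (X : finGroupType) (t : X -> X) (Y : finGroupType) (u : Y -> Y) :=
  (exists f, nearhom t u f) /\ (exists g, nearhom u t g).

Lemma iter_ppow p (X : finGroupType) i (x : X) : iter i (ppow p (X := X)) x = x ^+ (p ^ i).
Proof. by elim: i => //= i ->; rewrite /ppow -expgM expnSr. Qed.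

Section Matching.
Variables (p n : nat).
Hypotheses (p_pr : prime p) (le_np : n <= p).

(** The class is at most the larger of [1] and [n - 1], hence below [p], which makes ['L_p]
    trivial. *)
Lemma ppow_cnil (X : finGroupType) :
  order_derived_exp_p p n X -> cnil n (ppow p (X := X)).
Proof.
case=> oX /exponentP expX.
have pX : p.-group [set: X] by rewrite /pgroup oX pnatX pnat_id.
have Lp1 : 'L_p([set: X]) = 1.
  rewrite -(prednK (prime_gt0 p_pr)); apply/lcn_nil_classP; first exact: pgroup_nil pX.
  apply: leq_trans (nil_class_pgroup pX) _; rewrite oX pfactorK // geq_max.
  by have := prime_gt1 p_pr; lia.
split=> [x y | x y | x].
- by rewrite /ppow (expgMn_der1 p_pr Lp1) ?inE.
- have /centerP[_] := expgp_central p_pr Lp1 expX (in_setT x).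
  by apply; rewrite inE.
- by rewrite iter_ppow -oX expg_cardG ?inE.
Qed.

(** Commutators of [X] lie in the kernel of [t], which [f] sends onto a subgroup [B] killed by the
    p-power map; this bounds the exponent of the derived subgroup of [Y]. *)
Lemma match_up (X : finGroupType) (t : X -> X) :
    order_exp_p p n X -> cnil n t ->
  exists Y : finGroupType, order_derived_exp_p p n Y /\ matched t (ppow p (X := Y)).
Proof.
case=> oX /exponentP expX ct.
have {}expX (x : X) : x ^+ p = 1 by rewrite expX ?inE.
have [||Y [f [g sh]]] := twist_up p_pr (image_chain_chain ct) expX
    (image_chain_compat ct) (cnilM ct).
- by move=> x; apply/(image_chainP ct); exists x.
- by move=> i x; apply: (image_chainS ct).
have [[fK gK] _ fB fR [_ _ fT1]] := sh.
have bij_f : bijective f by exists g.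
pose B := [set f b | b in [set b | t b == 1]].
have oY : order_derived_exp_p p n Y.
  split; first by rewrite cardsT -(bij_eq_card bij_f) -cardsT.
  have gB : group_set B.
    apply/group_setP; split.
      by apply/imsetP; exists 1; rewrite ?inE ?(cnil_1 ct) ?(law1 fR).
    move=> _ _ /imsetP[a + ->] /imsetP[b + ->]; rewrite !inE => /eqP ta /eqP tb.
    by rewrite -fB // imset_f // inE (cnilM ct) ta tb mulg1.
  have sB : [set: Y]^`(1) \subset Group gB.
    rewrite gen_subG; apply/subsetP=> _ /imset2P[x y _ _ ->].
    by rewrite -[x]gK -[y]gK -fR imset_f // inE (cnil_comm ct).
  apply/exponentP=> y /(subsetP sB)/imsetP[b]; rewrite inE => /eqP tb ->.
  exact/fT1.
exists Y; split=> //.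
have [hf hg] := shadow_nearhom ct (cnilM (ppow_cnil oY)) sh.
by split; [exists f | exists g].
Qed.

Lemma match_down (X : finGroupType) : order_derived_exp_p p n X ->
  exists (E : finGroupType) (t : E -> E),
    [/\ order_exp_p p n E, cnil n t & matched t (ppow p (X := X))].
Proof.
move=> oX; have ct := ppow_cnil oX.
have [||E [f [g [t [tM expE sh]]]]] := twist_down p_pr (image_chain_chain ct)
    (image_chain_compat ct) (cnilM ct).
- by move=> x; apply/(image_chainP ct); exists x.
- by move=> i x; apply: (image_chainS ct).
have [[fK gK] _ _ _ _] := sh; have bij_f : bijective f by exists g.
exists E, t; split.
- split; first by rewrite cardsT -(bij_eq_card bij_f) -cardsT; case: oX.
  by apply/exponentP=> x _; apply: expE.
- exact: shadow_cnil sh.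
by have [hf hg] := shadow_nearhom ct tM sh; split; [exists g | exists f].
Qed.

End Matching.

(** * Isomorphisms, automorphism orbits and the count *)

Lemma isog_of_bij (X Y : finGroupType) (h : X -> Y) :
  {morph h : x y / x * y} -> bijective h -> [set: X] \isog [set: Y].
Proof.
move=> hM h_bij.
have hM' : {in [set: X] &, {morph h : x y / x * y}} by move=> x y _ _; apply: hM.
pose hm := Morphism hM'.
have inj_h : 'injm hm by apply/injmP=> x y _ _; apply: bij_inj h_bij x y.
apply/isogP; exists hm => //; apply/eqP; rewrite eqEcard subsetT card_injm //=.
by rewrite !cardsT (bij_eq_card h_bij) leqnn.
Qed.

Lemma bij_of_isog (X Y : finGroupType) : [set: X] \isog [set: Y] ->
  exists h : X -> Y, {morph h : x y / x * y} /\ bijective h.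
Proof.
case/isogP=> h inj_h im_h; exists h; split.
  by move=> x y; rewrite morphM ?inE.
apply: inj_card_bij; first by move=> x y; apply: (injmP inj_h); rewrite inE.
by rewrite -!cardsT -im_h card_injm.
Qed.

Lemma N_EP n (X : finGroupType) (s : {ffun X -> X}) : reflect (cnil n s) (s \in N_E n X).
Proof.
rewrite inE; apply: (iffP and3P) => [[/morphicP sM /subsetP sZ /forallP sN] | [sM sC sN]].
- split=> [x y | x y | x]; [by apply: sM; rewrite inE | | exact/eqP].
  have /centerP[_] : s x \in 'Z([set: X]) by apply: sZ; rewrite imset_f.
  by apply; rewrite inE.
split.
- by apply/morphicP=> x y _ _; apply: sM.
- apply/subsetP=> _ /imsetP[x _ ->]; apply/centerP; split=> [|y _]; rewrite ?inE //.
- by apply/forallP=> x; apply/eqP.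
Qed.

Lemma conj_endoM (X : finGroupType) (a b : {perm X}) s :
  conj_endo a (conj_endo b s) = conj_endo (b * a) s.
Proof. by apply/ffunP=> x; rewrite !ffunE invMg !permM. Qed.

Lemma conj_endo1 (X : finGroupType) (s : {ffun X -> X}) : conj_endo 1 s = s.
Proof. by apply/ffunP=> x; rewrite !ffunE invg1 !perm1. Qed.

Lemma aut_orbit_eq (X : finGroupType) (s s' : {ffun X -> X}) :
  s' \in aut_orbit s -> aut_orbit s' = aut_orbit s.
Proof.
case/imsetP=> a Aa ->; apply/setP=> r; apply/imsetP/imsetP=> [[b Ab ->] | [b Ab ->]].
  by exists (a * b); rewrite ?groupM // conj_endoM.
by exists (a^-1 * b); rewrite ?groupM ?groupV // conj_endoM mulKVg.
Qed.

Lemma aut_orbit_refl (X : finGroupType) (s : {ffun X -> X}) : s \in aut_orbit s.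
Proof. by apply/imsetP; exists 1; rewrite ?group1 ?conj_endo1. Qed.

Lemma aut_orbitP (X : finGroupType) (s s' : {ffun X -> X}) :
  reflect (exists h : X -> X, [/\ {morph h : x y / x * y}, bijective h
                                & forall x, h (s x) = s' (h x)])
          (s' \in aut_orbit s).
Proof.
apply: (iffP imsetP) => [[a Aa ->] | [h [hM h_bij hs]]].
  exists a; split; first by move=> x y; apply: (morphicP (Aut_morphic Aa)); rewrite inE.
    by exists (a^-1)%g; [apply: permK | apply: permKV].
  by move=> x; rewrite ffunE permK.
exists (perm (bij_inj h_bij)).
  rewrite inE; apply/andP; split; first by apply/subsetP=> x _; rewrite inE.
  by apply/morphicP=> x y _ _; rewrite !permE hM.
apply/ffunP=> x; rewrite ffunE permE hs; congr (s' _).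
by rewrite -(permE (bij_inj h_bij)) permKV.
Qed.

Theorem theorem1p2 (n p : nat) (hp : prime p) (hpn : (n <= p)%N)
  (m : nat) (E : 'I_m -> finGroupType) (hE : iso_reps (order_exp_p p n) E)
  (k : nat) (G : 'I_k -> finGroupType) (hG : iso_reps (order_derived_exp_p p n) G) :
  (k%:R : rat) = (\sum_(i < m) orbit_sum n (E i))%R.
Proof.
have [E_ok E_inj E_surj] := hE; have [G_ok G_inj G_surj] := hG.
have cG j := ppow_cnil hp hpn (G_ok j).
have expE i (x : E i) : x ^+ p = 1.
  by have [_ /exponentP->] := E_ok i; rewrite ?inE.
have oE i : #|E i| = (p ^ n)%N by have [<- _] := E_ok i; rewrite cardsT.
have oG j : #|G j| = (p ^ n)%N by have [<- _] := G_ok j; rewrite cardsT.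
pose M i (s : {ffun E i -> E i}) j := matched s (ppow p (X := G j)).
have M_ex i (s : {ffun E i -> E i}) : s \in N_E n (E i) -> exists j, M i s j.
  move/N_EP=> cs; have [Y [oY [[f nf] [g ng]]]] := match_up hp hpn (E_ok i) cs.
  have [j /bij_of_isog[h [hM h_bij]]] := G_surj Y oY; exists j.
  have cY := ppow_cnil hp hpn oY; have [h' hK h'K] := h_bij.
  have hX x : h (ppow p x) = ppow p (h x).
    rewrite /ppow; elim: (p) => [|q IHq]; last by rewrite !expgS hM IHq.
    by apply: (@mulgI _ (h 1)); rewrite -hM !mulg1.
  have h'M : {morph h' : x y / x * y}.
    by move=> x y; apply: (can_inj hK); rewrite hM !h'K.
  have h'X x : h' (ppow p x) = ppow p (h' x) by apply: (can_inj hK); rewrite hX !h'K.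
  have nh := nearhom_iso (cG j) hM (can_inj hK) hX.
  have nh' := nearhom_iso cY h'M (can_inj h'K) h'X.
  split; first by exists (h \o f); apply: nearhom_comp cY (cG j) nf nh.
  by exists (g \o h'); apply: nearhom_comp cY cs nh' ng.
have M_surj j : exists i s, s \in N_E n (E i) /\ M i s j.
  have [E0 [t [oE0 ct [[f nf] [g ng]]]]] := match_down hp hpn (G_ok j).
  have [i /bij_of_isog[h [hM [h' hK h'K]]]] := E_surj E0 oE0.
  pose s := [ffun x => h (t (h' x))]; exists i, s.
  have hs x : h (t x) = s (h x) by rewrite ffunE hK.
  have h's x : h' (s x) = t (h' x) by rewrite ffunE hK.
  have h'M : {morph h' : x y / x * y}.
    by move=> x y; apply: (can_inj hK); rewrite hM !h'K.
  have cs : cnil n s.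
    have [tM tC tN] := ct; split=> [x y | x y | x].
    - by rewrite !ffunE h'M tM hM.
    - by rewrite /commute !ffunE -[y]h'K -!hM tC.
    apply: (can_inj h'K); have -> : h' (iter n s x) = iter n t (h' x).
      by elim: (n) => //= q <-; rewrite h's.
    rewrite tN; apply: (can_inj hK); rewrite h'K.
    by apply: (@mulgI _ (h 1)); rewrite -hM !mulg1.
  split; first exact/N_EP.
  have nh := nearhom_iso cs hM (can_inj hK) hs.
  have nh' := nearhom_iso ct h'M (can_inj h'K) h's.
  split; first by exists (f \o h'); apply: nearhom_comp ct (cG j) nh' nf.
  by exists (h \o g); apply: nearhom_comp ct cs ng nh.
(* Pairs matched with the same group are linked through it, and the link lifts because both sides
   have exponent [p]; [M_G] is the mirror argument with p-power maps. *)
have M_E i s i' s' j :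
    s \in N_E n (E i) -> s' \in N_E n (E i') -> M i s j -> M i' s' j ->
  exists h : E i -> E i', [/\ {morph h : x y / x * y}, bijective h
                           & forall x, h (s x) = s' (h x)].
  move=> /N_EP cs /N_EP cs' [[f nf] _] [_ [g ng]].
  apply: (nearhom_lift hp cs cs' (nearhom_comp (cG j) cs' nf ng)); first by rewrite !oE.
  by left.
have M_orb i s s' j : s \in N_E n (E i) -> s' \in N_E n (E i) -> M i s j -> M i s' j ->
    s' \in aut_orbit s.
  by move=> Ns Ns' Ms Ms'; apply/aut_orbitP; apply: M_E Ms Ms'.
have N_orb i s s' : s \in N_E n (E i) -> s' \in aut_orbit s -> s' \in N_E n (E i).
  move=> /N_EP[sM sC sN] /aut_orbitP[h [hM [h' hK h'K] hs]]; apply/N_EP.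
  have h's x : h' (s' x) = s (h' x) by rewrite -{1}(h'K x) -hs hK.
  split=> [x y | x y | x].
  - by rewrite -(h'K x) -(h'K y) -hM -!hs sM hM.
  - by rewrite -(h'K x) -(h'K y) -hs /commute -!hM sC.
  apply: (can_inj h'K); have -> : h' (iter n s' x) = iter n s (h' x).
    by elim: (n) => //= q <-; rewrite h's.
  rewrite sN; apply: (can_inj hK); rewrite h'K.
  by apply: (@mulgI _ (h 1)); rewrite -hM !mulg1.
have M_G i s s' j j' :
  s \in N_E n (E i) -> s' \in aut_orbit s -> M i s j -> M i s' j' -> j = j'.
  move=> Ns os' [_ [g ng]] [[f nf] _]; have /N_EP cs' := N_orb _ _ _ Ns os'.
  have /N_EP cs := Ns; have [h [hM h_bij hs]] := aut_orbitP _ _ os'.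
  have nh := nearhom_iso cs' hM (bij_inj h_bij) hs.
  have ngh := nearhom_comp cs cs' ng nh.
  have nghf := nearhom_comp cs' (cG j') ngh nf.
  have [|| h1 [h1M h1_bij _]] := nearhom_lift hp (cG j) (cG j') nghf.
  - by rewrite !oG.
  - by right.
  exact: G_inj (isog_of_bij h1M h1_bij).
(* The option type gives a value outside [N_E], since ['I_k] offers no default element. *)
have /fin_all_exists[b bP] i : exists b : {ffun E i -> E i} -> option 'I_k,
    forall s, s \in N_E n (E i) -> exists2 j, b s = Some j & M i s j.
  apply: (@fin_all_exists _ (fun=> option 'I_k)
    (fun s o => s \in N_E n (E i) -> exists2 j, o = Some j & M i s j)).
  move=> s; case: (boolP (s \in N_E n (E i))) => [/M_ex[j Mj] | _]; last by exists None.
  by exists (Some j) => _; exists j.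
(* The weights are sorted by the group matched with each endomorphism. *)
transitivity (\sum_(j < k) \sum_(i < m) \sum_(s in N_E n (E i) | b i s == Some j)
                 (#|aut_orbit s|%:R : rat)^-1)%R; last first.
  rewrite exchange_big; apply: eq_bigr => i _; rewrite /orbit_sum.
  rewrite (exchange_big_dep (mem (N_E n (E i)))) /=; last by move=> j s _ /andP[].
  apply: eq_bigr => s Ns; have [j bs _] := bP i s Ns.
  rewrite (big_pred1 j) // => j'; rewrite bs /= Ns /=.
  by rewrite eq_sym; apply/eqP/eqP => [[] | ->].
rewrite -[k in LHS]card_ord -sumr_const; apply: eq_bigr => j _.
(* For fixed [j] only this [i] contributes, through the single orbit of [s], whose weights add up to
   [1]. *)
have [i [s [Ns Ms]]] := M_surj j.
rewrite (bigD1 i) //= [X in (_ + X)%R]big1 ?addr0; last first.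
  move=> i' neq_i; apply: big1 => s' /andP[Ns' /eqP bs'].
  have [j' ] := bP i' s' Ns'; rewrite bs' => -[<-] Ms'.
  have [h [hM h_bij _]] := M_E _ _ _ _ _ Ns Ns' Ms Ms'.
  by case/eqP: neq_i; apply/esym/E_inj/(isog_of_bij hM).
rewrite (eq_bigl (mem (aut_orbit s))) => [|s' /=]; last first.
  apply/andP/idP => [[Ns' /eqP bs'] | os'].
    have [j' ] := bP i s' Ns'; rewrite bs' => -[<-] Ms'.
    exact: M_orb Ms Ms'.
  have Ns' := N_orb _ _ _ Ns os'; split=> //.
  by have [j' -> Ms'] := bP i s' Ns'; rewrite (M_G _ _ _ _ _ Ns os' Ms Ms').
rewrite (eq_bigr (fun=> (#|aut_orbit s|%:R : rat)^-1)%R) => [|s' /aut_orbit_eq-> //].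
rewrite sumr_const -[RHS]mulr_natr mulVf // pnatr_eq0 -lt0n.
by apply/card_gt0P; exists s; apply: aut_orbit_refl.
Qed.
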